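(* Let $C$ be a longest cycle in a $(\delta-\lambda+1)$-connected graph $G$ of order $n$, where $\lambda$ is an integer with $1\le\lambda\le\delta$. If $\delta\geq \frac{n+2}{\lambda+1}+\lambda-2$, then $\overline{c}\le\min\{\lambda-1,\delta-\lambda\}$.
   Context: All graphs are finite, undirected, without loops or multiple edges. For a graph $G$ on $n$ vertices, $\delta$ denotes its minimum degree and $\kappa$ its connectivity. A cycle of order $t$ is a sequence $v_1\dots v_tv_1$ of distinct vertices with consecutive vertices adjacent; a single vertex is a cycle of order 1 and an edge a cycle of order 2. $C$ is a longest cycle of $G$, $c=|C|$ is the circumference, and $\overline{c}$ denotes the order of a longest cycle in $G-C$ (the subgraph obtained by deleting the vertices of $C$); $\overline{c}\le 0$ if $G-C$ is empty. *)

(* Defs.v *)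
From mathcomp Require Import all_boot all_order all_algebra.

Set Implicit Arguments.
Unset Strict Implicit.
Unset Printing Implicit Defensive.

Record sgraph := SGraph {
  vertex :> finType;
  adj : rel vertex;
  adj_sym : symmetric adj;
  adj_irr : irreflexive adj
}.

Definition degree (G : sgraph) (v : G) : nat := #|[set u | adj v u]|.

(* Every degree is less than #|G|, so the default value #|G| of the minimum
   only matters for the graph without vertices. *)
Definition min_degree (G : sgraph) : nat := \big[minn/#|G|]_(v : G) degree v.

Section Deletion.
Variables (G : sgraph) (S : {set G}).

Definition del_adj : rel {x : G | x \notin S} :=
  fun x y => adj (val x) (val y).

Fact del_adj_sym : symmetric del_adj.
Proof. by move=> x y; apply: adj_sym. Qed.

Fact del_adj_irr : irreflexive del_adj.
Proof. by move=> x; apply: adj_irr. Qed.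

(* The graph G - S. *)
Definition del : sgraph := SGraph del_adj_sym del_adj_irr.
End Deletion.

Definition connected_graph (G : sgraph) : Prop :=
  0 < #|G| /\ forall x y : G, connect (@adj G) x y.

(* The condition k < #|G| gives the complete graph on n vertices
   connectivity n - 1. *)
Definition k_connected (k : nat) (G : sgraph) : Prop :=
  k < #|G| /\ forall S : {set G}, #|S| < k -> connected_graph (del S).

(* A single vertex is a cycle of order 1; since adjacency is symmetric,
   path.cycle on two distinct vertices says that they form an edge. *)
Definition is_cycle (G : sgraph) (s : seq G) : bool :=
  [&& 0 < size s, uniq s & (size s == 1) || cycle (@adj G) s].

Definition longest_cycle (G : sgraph) (C : seq G) : Prop :=
  is_cycle C /\ forall D : seq G, is_cycle D -> size D <= size C.

(* The order of a longest cycle; it is 0 for the graph without vertices. *)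
Definition circumference (G : sgraph) : nat :=
  \max_(k < #|G|.+1 | [exists t : k.-tuple G, is_cycle t]) k.

Definition cbar (G : sgraph) (C : seq G) : nat :=
  circumference (del [set x in C]).

(* Main.v *)
Require Import Defs.
From mathcomp Require Import all_boot zify.
From Stdlib Require Import Classical.

(** Write [k] for [min_degree G - lambda + 1], [t] for the order of a longest
    cycle [H] of [G - C], and suppose [t >= min lambda k]; the hypothesis says
    [#|G| + 2 <= (lambda + 1) (k + 1)].

    From every vertex of [H] grow a path avoiding [C] and the rest of [H], all
    paths disjoint, maximising first the number of nontrivial paths and then
    their total size.  The tips of the paths label the vertices of [C] they are
    adjacent to, and two labelled vertices of [C] are far apart on [C] because a
    detour through [G - C] joins them; summing the gaps bounds [size C] from
    below by the number of labels plus the number of labelled vertices.  The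
    maximality of the system and of [H] bounds the neighbours of the tips outside
    [C].  If [t] lies between [lambda] and [k] this already makes [G] too large.

    If [t > max lambda k], Menger's theorem links [H] to [C] by [k] disjoint
    paths.  Either all pairs of their ends on [C] are joined by paths through
    [G - C] with at least [lambda] inner vertices, so [size C >= k (lambda + 1)],
    or some two vertices [x], [y] of [H] are joined only by short paths of
    [G - C].  In the second case [H] has few chords between the two arcs cut out
    by [x] and [y], the tips have few neighbours outside [C] on average, and the
    labels again make [G] too large. *)

Set Implicit Arguments.
Unset Strict Implicit.
Unset Printing Implicit Defensive.

(** * Spaced weights on a line and on a cycle *)

Section Charging.
Implicit Types (g : nat -> nat) (a b m : nat).

(** If [g a] is positive, the positions strictly between [a] and [a + g a] have weight 0, since a
    positive one would be closer than [g a] permits. The sum then continues at [a + g a]; the end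
    [b] counts as occupied. *)
Lemma sum_spaced_left g a b :
  (forall m m', a <= m -> m < m' -> m' <= b -> 0 < g m ->
     (m' == b) || (0 < g m') -> g m <= m' - m) ->
  \sum_(a <= m < b) g m <= b - a.
Proof.
have [n] := ubnP (b - a); elim: n a => // n IHn a ltn Hg.
have [leba|ltab] := leqP b a; first by rewrite big_geq.
have [ga0|ga0] := posnP (g a).
  rewrite big_ltn // ga0 add0n; apply: leq_trans (IHn a.+1 _ _) _; [lia| |lia].
  by move=> m m' lem; apply: Hg; lia.
have gab : g a <= b - a by apply: Hg; rewrite ?eqxx.
rewrite (big_cat_nat (n := a + g a)) /=; [|lia|lia].
have -> : \sum_(a <= m < a + g a) g m = g a.
  rewrite big_ltn; last by lia.
  rewrite big_nat_cond big1 ?addn0 // => m /andP[/andP[lem ltm] _].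
  apply/eqP; rewrite -leqn0 leqNgt; apply/negP => gm.
  have : g a <= m - a by apply: Hg => //; rewrite ?gm ?orbT //; lia.
  by move=> ?; lia.
have : \sum_(a + g a <= m < b) g m <= b - (a + g a).
  by apply: IHn; [lia | move=> m m' lem; apply: Hg; lia].
by move=> ?; lia.
Qed.

(** Reflection of the interval reduces this to the previous lemma, with [a] as the occupied end. *)
Lemma sum_spaced_right g a b :
  (forall m m', a <= m -> m < m' -> m' <= b -> 0 < g m' ->
     (m == a) || (0 < g m) -> g m' <= m' - m) ->
  \sum_(a.+1 <= m < b.+1) g m <= b - a.
Proof.
move=> Hg; have [leba|ltab] := leqP b a; first by rewrite big_geq //; lia.
rewrite big_nat_rev /=.
rewrite (@eq_big_nat _ _ _ _ _ _ (fun m => g (a.+1 + b.+1 - m.+1))) //.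
have := @sum_spaced_left (fun m => if m <= b then g (a.+1 + b - m) else 0) a.+1 b.+1.
have -> : b.+1 - a.+1 = b - a by lia.
rewrite (@eq_big_nat _ _ _ a.+1 b.+1 _ (fun m => g (a.+1 + b.+1 - m.+1))); last first.
  by move=> m /andP[lem ltm]; rewrite -ltnS ltm; congr g; lia.
apply=> m m' lem ltm lem' gm gm'.
have lemb : m <= b by lia.
rewrite lemb in gm *.
have -> : m' - m = (a.+1 + b - m) - (a.+1 + b - m') by lia.
apply: Hg => //; try lia.
case/orP: gm' => [/eqP->|]; first by apply/orP; left; apply/eqP; lia.
by case: (leqP m' b) => // _ gm'; apply/orP; right.
Qed.

Lemma big_nat_ord_mod g a t : 0 < t -> (forall m, g (m + t) = g m) ->
  \sum_(a <= m < a + t) g m = \sum_(i < t) g i.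
Proof.
move=> t_gt0 gP; elim: a => [|a IHa]; first by rewrite add0n big_mkord.
rewrite -IHa addSn big_nat_recr /=; last by lia.
by rewrite gP addnC -big_ltn // -addn1 leq_add2l.
Qed.

(** Cut at an occupied position [i]: by periodicity the window from [i] to [i + t] has an occupied
    end. Allowing [d = t] covers a single occupied position. *)
Lemma sum_spaced_cyclic g t : 0 < t -> (forall m, g (m + t) = g m) ->
  (forall m d, 0 < d <= t -> 0 < g m -> 0 < g (m + d) -> g m <= d) ->
  \sum_(i < t) g i <= t.
Proof.
move=> t_gt0 gP Hg.
have [/existsP[i gi]|] := boolP [exists i : 'I_t, 0 < g i]; last first.
  rewrite negb_exists => /forallP H0; rewrite big1 // => i _.
  by apply/eqP; rewrite -leqn0 leqNgt H0.
rewrite -(big_nat_ord_mod i t_gt0 gP).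
rewrite -[leqRHS](addKn i t); apply: sum_spaced_left => m m' lem ltm lem' gm gm'.
have [d hd Em'] : exists2 d, 0 < d <= t & m' = m + d by exists (m' - m); lia.
rewrite Em' in gm' *; rewrite addKn; apply: Hg => //.
by case/orP: gm' => // /eqP ->; rewrite gP.
Qed.

End Charging.

Lemma exists_min (A : Type) (P : A -> Prop) (f : A -> nat) :
  (exists a, P a) -> exists2 a, P a & forall a', P a' -> f a <= f a'.
Proof.
move=> [a0 Pa0]; have [n] := ubnP (f a0); elim: n a0 Pa0 => // n IHn a Pa lt.
have [[a' Pa' lta]|H] := classic (exists2 a', P a' & f a' < f a).
  by apply: (IHn a') => //; lia.
exists a => // a' Pa'; rewrite leqNgt; apply/negP => lta; apply: H; by exists a'.
Qed.

Lemma exists_max (A : Type) (P : A -> Prop) (f : A -> nat) N :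
  (exists a, P a) -> (forall a, P a -> f a <= N) ->
  exists2 a, P a & forall a', P a' -> f a' <= f a.
Proof.
move=> exP leN; have [a Pa amin] := exists_min (fun a => N - f a) exP.
by exists a => // a' Pa'; have := amin _ Pa'; have := leN _ Pa; have := leN _ Pa'; lia.
Qed.

(** * Paths, cycles and detours *)

Section Paths.
Variable G : sgraph.
Implicit Types (x y z : G) (p q s : seq G).

(** Both ends are listed, so the size counts vertices, and two paths are joined by an edge from the
    end of one to the start of the other. *)
Definition path_between x y p : bool :=
  if p is a :: q then [&& a == x, path (@adj G) a q & last a q == y] else false.

Lemma path_between_seq1 x : path_between x x [:: x].
Proof. by rewrite /= !eqxx. Qed.

Lemma path_between_cat x y x' y' p p' :
  path_between x y p -> adj y x' -> path_between x' y' p' ->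
  path_between x y' (p ++ p').
Proof.
case: p => //= a q /and3P[-> pq /eqP lq] yx'.
case: p' => //= b q' /and3P[/eqP bx' pq' /eqP lq'].
by rewrite cat_path pq /= last_cat /= lq bx' yx' -bx' pq' lq' eqxx.
Qed.

Lemma path_between_rev x y p : path_between x y p -> path_between y x (rev p).
Proof.
case: p => //= a q /and3P[/eqP-> pq /eqP lq].
have := rev_path (@adj G) x q; rewrite lq => Hr.
have Er : rev (x :: q) = y :: rev (belast x q) by rewrite lastI lq rev_rcons.
rewrite Er /= eqxx Hr /=; apply/andP; split.
  by rewrite (@eq_path _ _ (@adj G)) // => u v; rewrite adj_sym.
case: q {pq Hr Er} lq => [|b q] /= lq; first by rewrite lq.
by rewrite rev_cons last_rcons.
Qed.

Lemma path_between_size x y p : path_between x y p -> 0 < size p.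
Proof. by case: p. Qed.

End Paths.

(** * Cycles indexed periodically by the natural numbers *)

Section CyclicIndexing.
Variables (G : sgraph) (x0 : G) (H : seq G).
Hypothesis cH : is_cycle H.

Definition cnth (n : nat) : G := nth x0 H (n %% size H).

Lemma cycle_size_gt0 : 0 < size H.
Proof. by case/and3P: cH. Qed.

Lemma cnth_in n : cnth n \in H.
Proof. by rewrite mem_nth // ltn_pmod // cycle_size_gt0. Qed.

Lemma cnth_addt n : cnth (n + size H) = cnth n.
Proof. by rewrite /cnth modnDr. Qed.

Lemma cnth_inj_mod m n : cnth m = cnth n -> m = n %[mod size H].
Proof.
move=> /eqP; rewrite nth_uniq ?ltn_pmod ?cycle_size_gt0 //; first by move/eqP.
by case/and3P: cH.
Qed.

Lemma cnth_inj_window B m n : B <= m < B + size H -> B <= n < B + size H ->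
  cnth m = cnth n -> m = n.
Proof.
move=> hm hn /cnth_inj_mod /eqP.
have -> : m = B + (m - B) by lia.
have -> : n = B + (n - B) by lia.
by rewrite eqn_modDl !modn_small => [/eqP|//|//]; lia.
Qed.

Lemma cnth_surj x : x \in H -> exists2 n, n < size H & x = cnth n.
Proof.
move=> xH; exists (index x H); first by rewrite index_mem.
by rewrite /cnth modn_small ?index_mem // nth_index.
Qed.

Lemma adj_cnthS n : 1 < size H -> adj (cnth n) (cnth n.+1).
Proof.
move=> H1; have cyH : cycle (@adj G) H.
  by case/and3P: cH => _ _ /orP[/eqP E|//]; rewrite E in H1.
have H0 := cycle_size_gt0.
have -> : cnth n.+1 = cnth (n %% size H).+1 by rewrite /cnth -addn1 -[in RHS]addn1 modnDml.
rewrite {1}/cnth; have := ltn_pmod n H0; move: (n %% size H) => m ltm.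
rewrite /cnth.
have [E|ltm1] : m.+1 = size H \/ m.+1 < size H by lia.
  rewrite E modnn; have -> : m = (size H).-1 by lia.
  by case: (H) cyH H0 => //= a q; rewrite rcons_path /= => /andP[_]; rewrite (last_nth x0) => + _.
rewrite modn_small //; case: (H) cyH ltm1 => //= a q; rewrite rcons_path => /andP[pq _] lt.
by move/(pathP x0): pq; apply.
Qed.

Lemma uniq_map_cnth B ps : uniq ps -> (forall m, m \in ps -> B <= m < B + size H) ->
  uniq [seq cnth m | m <- ps].
Proof.
move=> ups hB; rewrite map_inj_in_uniq // => m n /hB hm /hB hn.
exact: cnth_inj_window hm hn.
Qed.

Lemma path_between_cnth m n : 1 < size H -> m <= n ->
  path_between (cnth m) (cnth n) [seq cnth i | i <- iota m (n.+1 - m)].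
Proof.
move=> H1 /subnKC <-; move: (n - m) => d.
have -> : (m + d).+1 - m = d.+1 by lia.
elim: d m => [|d IHd] m; first by rewrite addn0 path_between_seq1.
have -> : iota m d.+2 = [:: m] ++ iota m.+1 d.+1 by [].
rewrite map_cat; apply: path_between_cat (path_between_seq1 _) (adj_cnthS _ H1) _.
by rewrite addnS -addSn; apply: IHd.
Qed.

Lemma path_between_cnth_rev m n : 1 < size H -> m <= n ->
  path_between (cnth n) (cnth m) [seq cnth i | i <- rev (iota m (n.+1 - m))].
Proof. by move=> H1 lemn; rewrite map_rev; apply/path_between_rev/path_between_cnth. Qed.

(* Replacing an arc of [d] edges of a longest cycle by a detour with [size s]
   inner vertices gives a cycle again. *)
Lemma detour_size (Z : pred G) n d h k s :
  (forall D, is_cycle D -> {in D, forall v, ~~ Z v} -> size D <= size H) ->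
  {in H, forall v, ~~ Z v} ->
  0 < d <= size H -> adj (cnth n) h -> path_between h k s -> adj k (cnth (n + d)) ->
  uniq s -> {in s, forall v, (v \notin H) && ~~ Z v} -> size s < d.
Proof.
move=> Hmax HZ dP nh ps kn us sP.
have s0 := path_between_size ps.
(* The complementary arc, from [n + d] on to [n + size H]; closed up by [s] it is a cycle that
   avoids [Z]. *)
pose a := [seq cnth i | i <- iota (n + d) ((n + size H).+1 - (n + d))].
have sza : size a = (size H - d).+1 by rewrite size_map size_iota; lia.
have pa : path_between (cnth (n + d)) (cnth n) a.
  have [H1|H1] := ltnP 1 (size H).
    by rewrite -(cnth_addt n); apply: path_between_cnth => //; lia.
  (* A cycle of order 1 has no edge to follow; the arc is its only vertex. *)
  have E : size H = 1 by lia.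
  have Ed : d = 1 by lia.
  rewrite /a Ed E; have -> : (n + 1).+1 - (n + 1) = 1 by lia.
  by have := cnth_addt n; rewrite E /= => ->; rewrite !eqxx.
have ua : uniq a.
  apply: (@uniq_map_cnth (n + d)) (iota_uniq _ _) _ => m.
  by rewrite mem_iota; lia.
have aH : {in a, forall v, v \in H} by move=> v /mapP[m _ ->]; apply: cnth_in.
have pas := path_between_cat pa nh ps.
have cD : is_cycle (a ++ s).
  apply/and3P; split; rewrite ?size_cat; first by lia.
    rewrite cat_uniq ua us andbT /=; apply/hasPn => v vs.
    by apply/negP => /aH; apply/negP; have /andP[] := sP _ vs.
  apply/orP; right; case: (a ++ s) pas => //= b q /and3P[/eqP-> pq /eqP lq].
  by rewrite rcons_path pq lq.
have : size (a ++ s) <= size H.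
  apply: Hmax => // v; rewrite mem_cat => /orP[/aH/HZ//|/sP/andP[]//].
by rewrite size_cat sza; clear -dP s0; lia.
Qed.

End CyclicIndexing.

(** * Weights on a longest cycle bounded by gaps *)

Section GapCounting.
Variables (G : sgraph) (x0 : G) (C : seq G).
Hypothesis lC : longest_cycle C.

Let cC : is_cycle C. Proof. by case: lC. Qed.

(** The detour lies off [C], so by [detour_size] an arc from [z] to [z'] has more than [size s]
    edges, hence at least [W z]. The first hypothesis handles a full turn around [C]. *)
Lemma sum_gaps (W : G -> nat) :
  (forall z, z \in C -> 0 < W z -> W z <= size C) ->
  (forall z z', z \in C -> z' \in C -> z != z' -> 0 < W z -> 0 < W z' ->
     exists h k s, [/\ adj z h, path_between h k s, adj k z', uniq s &
       {in s, forall v, v \notin C} /\ W z <= (size s).+1]) ->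
  \sum_(z in C) W z <= size C.
Proof.
move=> W1 W2; pose g n := W (cnth x0 C n).
have E : \sum_(i < size C) g i = \sum_(z in C) W z.
  rewrite -big_uniq /=; last by case/and3P: cC.
  rewrite (big_nth x0) big_mkord; apply: eq_bigr => i _.
  by rewrite /g /cnth modn_small.
rewrite -E; apply: sum_spaced_cyclic.
- exact: cycle_size_gt0 cC.
- by move=> m; rewrite /g cnth_addt.
move=> m d hd gm gmd.
have [Em|neq] := eqVneq (cnth x0 C m) (cnth x0 C (m + d)).
  have /(cnth_inj_mod cC)/eqP := Em; rewrite -{1}[m]addn0 eqn_modDl mod0n => Ed.
  have -> : d = size C.
    have [] : d < size C \/ d = size C by lia.
      by move=> ltd; rewrite modn_small // in Ed; lia.
    by [].
  by apply: W1; rewrite ?cnth_in.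
have [h [k [s [mh ps kmd us [sC le]]]]] := W2 _ _ (cnth_in x0 cC m) (cnth_in x0 cC (m + d)) neq gm gmd.
apply: leq_trans le _.
apply: (@detour_size _ x0 C cC pred0 m d h k s) => //.
  by move=> D cD _; case: lC => _; apply.
by move=> v /sC ->.
Qed.

End GapCounting.

(** * Menger's theorem *)

Section Menger.
Variable T : finType.
Implicit Types (e : rel T) (A B S : {set T}) (p q : seq T).

Definition set_path e A B p : bool :=
  if p is a :: q then [&& a \in A, path e a q & last a q \in B] else false.

Definition separates e A B S : Prop := forall p, set_path e A B p -> has (mem S) p.

Definition linked e A B k : Prop := exists (D : {set T}) (P : T -> seq T),
  [/\ #|D| = k, forall s, s \in D -> set_path e A B (P s) && uniq (P s) &
      forall s s' v, s \in D -> s' \in D -> v \in P s -> v \in P s' -> s = s'].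

Definition converse e : rel T := fun u v => e v u.

Lemma set_path_rev e A B p : set_path e A B p -> set_path (converse e) B A (rev p).
Proof.
case: p => //= a q /and3P[aA pq lB].
have Er : rev (a :: q) = last a q :: rev (belast a q) by rewrite lastI rev_rcons.
rewrite Er /= lB /=; apply/andP; split; first by rewrite rev_path.
by case: q {pq lB Er} => //= b q; rewrite rev_cons last_rcons.
Qed.

Lemma separates_converse e A B S : separates (converse e) B A S -> separates e A B S.
Proof. by move=> sepS p /set_path_rev/sepS; rewrite has_rev. Qed.

(** The ends of [k] disjoint paths are distinct, so they exhaust a target set of [k] vertices and
    can index the paths. *)
Lemma linked_by_last e A S k : linked e A S k -> #|S| = k ->
  exists P : T -> seq T, [/\ forall s, s \in S -> set_path e A [set s] (P s),
    forall s, s \in S -> uniq (P s) &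
    forall s s' v, s \in S -> s' \in S -> v \in P s -> v \in P s' -> s = s'].
Proof.
move=> [D [P [cD PD Pdis]]] cS.
pose lst s := last s (P s).
have lastP s : s \in D -> exists a q, [/\ P s = a :: q, last a q = lst s & lst s \in S].
  move=> sD; have /andP[] := PD s sD; rewrite /lst; case: (P s) => //= a q /and3P[_ _ l] _.
  by exists a, q.
have lst_inj : {in D &, injective lst}.
  move=> s s' sD s'D E; have [a [q [Es ls _]]] := lastP s sD.
  have [a' [q' [Es' ls' _]]] := lastP s' s'D.
  apply: (Pdis s s' (lst s)) => //; first by rewrite Es -ls mem_last.
  by rewrite E Es' -ls' mem_last.
have imD : [set lst s | s in D] = S.
  apply/eqP; rewrite eqEcard card_in_imset // cD cS leqnn andbT.
  by apply/subsetP => _ /imsetP[s sD ->]; have [a [q []]] := lastP s sD.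
pose idx s := odflt s [pick i in D | lst i == s].
have idxP s : s \in S -> idx s \in D /\ lst (idx s) = s.
  rewrite -imD => /imsetP[i iD Ei]; rewrite /idx; case: pickP => /= [j /andP[-> /eqP]//|].
  by move/(_ i); rewrite iD Ei eqxx.
exists (fun s => P (idx s)); split.
- move=> s sS; have [iD El] := idxP s sS; have [a [q [Es ls _]]] := lastP _ iD.
  have /andP[] := PD _ iD; rewrite /= Es /= => /and3P[-> -> _] _.
  by rewrite ls El inE eqxx.
- by move=> s sS; have [iD _] := idxP s sS; case/andP: (PD _ iD).
move=> s s' v sS s'S vs vs'; have [iD <-] := idxP s sS; have [i'D <-] := idxP s' s'S.
by rewrite (Pdis _ _ _ iD i'D vs vs').
Qed.

(** The edge from [x] to [y] is not traversed if [x] occurs at most as the end or [y] does not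
    occur. *)
Lemma path_avoid_edge e x y a q : x \notin belast a q \/ y \notin a :: q ->
  path e a q -> path [rel u v | e u v && ((u, v) != (x, y))] a q.
Proof.
elim: q a => //= b q IHq a Hn /andP[-> pq] /=; apply/andP; split.
  apply/eqP => -[Ea Eb]; case: Hn; first by rewrite inE Ea eqxx.
  by rewrite !inE Eb eqxx !orbT.
apply: IHq pq; case: Hn; rewrite inE negb_or => /andP[_ H]; [by left|by right].
Qed.

Lemma split_first p (S : {set T}) : has (mem S) p ->
  exists p1 w p2, [/\ p = p1 ++ w :: p2, w \in S & ~~ has (mem S) p1].
Proof.
elim: p => //= a p IHp; case: (boolP (a \in S)) => [aS _|aS /= /IHp].
  by exists [::], a, p.
case=> p1 [w [p2 [-> wS H1]]]; exists (a :: p1), w, p2; split=> //=.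
by rewrite (negbTE aS).
Qed.

(** Induction on the number of edges. Delete an edge from [x] to [y]. If some [S] with fewer than
    [k] vertices now separates, then [x |: S] and [y |: S] separate in [e] and have exactly [k]
    vertices. Induction links [A] to the first and, through the converse relation, the second to
    [B]; the paths are glued in [S] and along the deleted edge. *)
Theorem menger e A B k : irreflexive e ->
  (forall S, separates e A B S -> k <= #|S|) -> linked e A B k.
Proof.
have [n] := ubnP #|[set uv : T * T | e uv.1 uv.2]|.
elim: n => // n IHn in e A B k *.
move=> ltn irr Hk.
(* Without edges every path from [A] to [B] is a single vertex of [A :&: B], so this set
   separates. *)
have [noe|] := boolP [forall uv : T * T, ~~ e uv.1 uv.2].
  have kAB : k <= #|A :&: B|.
    apply: Hk => -[|a [|b q]] //=; last first.
      by have /forallP/(_ (a, b))/= /negbTE -> := noe; rewrite /= andbF.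
    by rewrite inE => /andP[-> ->].
  exists [set s in take k (enum (A :&: B))], (fun s => [:: s]); split.
  - rewrite cardsE (card_uniqP _) ?take_uniq ?enum_uniq // size_takel //.
    by rewrite -cardE.
  - move=> s; rewrite inE => /mem_take; rewrite mem_enum inE => /andP[sA sB] /=.
    by rewrite sA sB.
  by move=> s s' v _ _; rewrite !inE => /eqP <- /eqP.
rewrite negb_forall => /existsP[[x y] /= /negPn exy].
pose e' := [rel u v | e u v && ((u, v) != (x, y))].
have e'e : subrel e' e by move=> u v /andP[].
have irr' : irreflexive e' by move=> u /=; rewrite irr.
have lt' : #|[set uv : T * T | e' uv.1 uv.2]| < n.
  rewrite ltnS in ltn; apply: leq_trans ltn; apply: proper_card; apply/properP; split.
    by apply/subsetP => uv; rewrite !inE => /andP[].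
  by exists (x, y); rewrite inE //= eqxx andbF.
have liftp A1 B1 p : set_path e' A1 B1 p -> set_path e A1 B1 p.
  by case: p => //= a q /and3P[-> pq ->]; rewrite (sub_path e'e pq).
have [Hk'|] := classic (forall S, separates e' A B S -> k <= #|S|).
  have [D [P [cD PD Pd]]] := IHn e' A B k lt' irr' Hk'.
  exists D, P; split=> // s sD; have /andP[ps ->] := PD s sD; by rewrite liftp.
move=> /not_all_ex_not[S NS]; have [sepS /negP] := imply_to_and _ _ NS.
rewrite -ltnNge => ltS.
(* A path missing [S0] cannot use the deleted edge, so it survives in [e'] and meets [S]. *)
have avoid S0 : x \in S0 \/ y \in S0 -> S \subset S0 -> separates e A B S0.
  move=> xyS /subsetP SS0 p pp; apply/negPn/negP => /hasPn nS0.
  have : set_path e' A B p.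
    case: p pp nS0 => //= a q /and3P[-> pq ->] nS0; rewrite andbT /=.
    apply: path_avoid_edge pq; case: xyS => [xS|yS]; [left|right].
      by apply/negP => /mem_belast /nS0; rewrite /= xS.
    by apply/negP => /nS0; rewrite /= yS.
  move/sepS/hasP => [v vp vS]; have := nS0 v vp; by rewrite /= SS0.
have xS : x \notin S.
  by apply/negP => xS; have := Hk S (avoid _ (or_introl xS) (subxx _)); lia.
have yS : y \notin S.
  by apply/negP => yS; have := Hk S (avoid _ (or_intror yS) (subxx _)); lia.
have xy : x != y by apply/eqP => E; rewrite E irr in exy.
have sep1 : separates e A B (x |: S).
  by apply: avoid; [left; rewrite setU11 | apply: subsetUr].
have sep2 : separates e A B (y |: S).
  by apply: avoid; [right; rewrite setU11 | apply: subsetUr].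
have c1 : #|x |: S| = k by have := Hk _ sep1; rewrite cardsU1 xS; lia.
have c2 : #|y |: S| = k by rewrite -c1 !cardsU1 xS yS.
have [P [Pp Pu Pd]] : exists P : T -> seq T,
    [/\ forall s, s \in x |: S -> set_path e' A [set s] (P s),
    forall s, s \in x |: S -> uniq (P s) &
    forall s s' v, s \in x |: S -> s' \in x |: S -> v \in P s -> v \in P s' -> s = s'].
  (* A path of [e] cut at its first vertex in [x |: S] contains [x] at most as its end and so lies
     in [e']. Hence a set separating [A] from [x |: S] in [e'] separates [A] from [B] in [e]. *)
  apply: linked_by_last c1; apply: IHn lt' irr' _ => S' sepS'.
  apply: Hk => p pp; have [p1 [w [p2 [Ep w1 n1]]]] := split_first (sep1 p pp).
  suff : set_path e' A (x |: S) (rcons p1 w).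
    move/sepS'; rewrite Ep !has_cat has_rcons /= => /orP[->|->] //.
    by rewrite orbT.
  have xp1 : x \notin p1.
    by apply/negP => xp1; move/hasPn/(_ x xp1): n1; rewrite /= setU11.
  move: pp; rewrite Ep; case: p1 {Ep n1} xp1 => [|a q] xp1 /=.
    by case/and3P=> -> _ _; rewrite w1.
  rewrite cat_path /= => /and3P[-> /and3P[pq l _] _]; rewrite last_rcons w1 andbT /=.
  apply: path_avoid_edge; first by left; rewrite belast_rcons.
  by rewrite rcons_path pq.
have [Q [Qp Qu Qd]] : exists Q : T -> seq T,
    [/\ forall s, s \in y |: S -> set_path e' [set s] B (Q s),
    forall s, s \in y |: S -> uniq (Q s) &
    forall s s' v, s \in y |: S -> s' \in y |: S -> v \in Q s -> v \in Q s' -> s = s'].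
  have [Q [Qp Qu Qd]] : exists P : T -> seq T,
      [/\ forall s, s \in y |: S -> set_path (converse e') B [set s] (P s),
      forall s, s \in y |: S -> uniq (P s) &
      forall s s' v, s \in y |: S -> s' \in y |: S -> v \in P s -> v \in P s' -> s = s'].
    apply: linked_by_last c2; apply: IHn; first 1 last.
    - by move=> u; apply: irr'.
    - move=> S' /separates_converse sepS'; apply: Hk => p pp.
      have [p1 [w [p2 [Ep w1 n1]]]] : exists p1 w p2,
          [/\ rev p = p1 ++ w :: p2, w \in y |: S & ~~ has (mem (y |: S)) p1].
        by apply: split_first; rewrite has_rev; apply: sep2.
      have {}Ep : p = rev p2 ++ w :: rev p1.
        by rewrite -[p]revK Ep rev_cat rev_cons cat_rcons.
      suff : set_path e' (y |: S) B (w :: rev p1).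
        by move/sepS'; rewrite Ep has_cat => ->; rewrite orbT.
      have yp1 : y \notin rev p1.
        apply/negP; rewrite mem_rev => yp1; move/hasPn/(_ y yp1): n1.
        by rewrite /= setU11.
      have pw : path e w (rev p1) /\ last w (rev p1) \in B.
        move: pp; rewrite Ep; case: (rev p2) => [|a q] /=; first by case/and3P.
        by rewrite cat_path last_cat /= => /and3P[_ /and3P[_ _ ->] ->].
      rewrite /= w1 (proj2 pw) andbT /=; have {pw} [pw _] := pw.
      elim: (rev p1) w pw yp1 {w1 Ep} => //= b q IHq w /andP[ewb pq].
      rewrite inE negb_or => /andP[yb yq]; rewrite ewb IHq // andbT /=.
      by rewrite xpair_eqE (eq_sym b) (negbTE yb) andbF.
    apply: leq_ltn_trans lt'.
    apply: leq_trans (leq_imset_card (fun uv => (uv.2, uv.1)) _).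
    apply/subset_leq_card/subsetP => -[u v]; rewrite inE /converse /= => euv.
    by apply/imsetP; exists (v, u); rewrite ?inE.
  exists (fun s => rev (Q s)); split.
  - move=> s /Qp/set_path_rev; exact.
  - by move=> s /Qu; rewrite rev_uniq.
  by move=> s s' v s2 s2'; rewrite !mem_rev; apply: Qd.
have Plast s : s \in x |: S -> exists a q, [/\ P s = a :: q, a \in A, path e' a q & last a q = s].
  by move/Pp; case: (P s) => //= a q /and3P[aA pq]; rewrite inE => /eqP; exists a, q.
have Qhead s : s \in y |: S -> exists q, [/\ Q s = s :: q, path e' s q & last s q \in B].
  by move/Qp; case: (Q s) => //= a q /and3P[]; rewrite inE => /eqP-> ? ?; exists q.
(* Following [P s] up to [v] and then [Q s'] gives a path of [e'], which meets [S] in some [w].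
   Before [v], [w] would be the end of [P s], which comes no earlier than [v]; so [w] is the start
   of [Q s'], and this forces [v = w]. *)
have meet s s' v : s \in x |: S -> s' \in y |: S -> v \in P s -> v \in Q s' ->
    v = s /\ v = s'.
  move=> s1 s2 vP vQ.
  have [a [q [EP aA pq lq]]] := Plast s s1; have [q' [EQ pq' lq']] := Qhead s' s2.
  have sin w : w \in S -> w \in x |: S /\ w \in y |: S.
    by move=> wS; rewrite !inE wS !orbT.
  case/splitPr E1 : {1}(P s) / vP => [p1 p2].
  case/splitPr E2 : {1}(Q s') / vQ => [q1 q2].
  have : set_path e' A B (p1 ++ v :: q2).
    have [pv lv] : path e' v q2 /\ last v q2 \in B.
      move: E2; rewrite EQ; case: q1 => [[<- <-]//|b q1 [Eb Eq]].
      by move: pq' lq'; rewrite Eq cat_path last_cat /= => /and3P[].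
    move: E1; rewrite EP; case: p1 => [[Ea _]|b p1 [<- Eq]] /=.
      by rewrite pv lv -Ea aA.
    move: pq; rewrite Eq !cat_path /= => /and3P[-> -> _].
    by rewrite aA pv last_cat /= lv.
  have uP := Pu s s1; have uQ := Qu s' s2; rewrite E1 in uP; rewrite E2 in uQ.
  move/sepS/hasP => [w + wS]; have [w1 w2] := sin w wS.
  rewrite mem_cat => /orP[wp1|wq2].
    have Ew : w = s.
      have [a' [r [Ew _ _ lr]]] := Plast w w1.
      apply: (Pd w s w) => //; first by rewrite Ew -lr mem_last.
      by rewrite E1 mem_cat wp1.
    have sl : s \in v :: p2.
      have -> : s = last v p2.
        by move: lq; rewrite -[last a q]/(last a (a :: q)) -EP E1 last_cat.
      exact: mem_last.
    by move: uP; rewrite cat_uniq => /and3P[_ /hasPn/(_ s sl)]; rewrite /= -Ew wp1.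
  have Ew : w = s'.
    have [r [Ew _ _]] := Qhead w w2.
    apply: (Qd w s' w) => //; first by rewrite Ew mem_head.
    by rewrite E2 mem_cat wq2 orbT.
  have q10 : q1 = [::].
    case: q1 E2 uQ => // b q1; rewrite EQ => -[<- _].
    rewrite cat_uniq => /and3P[_ /hasPn/(_ w wq2)] /=.
    by rewrite Ew inE eqxx.
  have Ev : v = s' by move: E2; rewrite EQ q10 => -[].
  split=> //; apply: (Pd v s v) => //; first by rewrite Ev -Ew.
    have [a' [r [Ev' _ _ lr]]] := Plast w w1.
    by rewrite Ev -Ew Ev' -{1}lr mem_last.
  by rewrite E1 mem_cat mem_head orbT.
have QS s : s \in x |: S -> s != x -> s \in y |: S.
  by rewrite !inE => /orP[->//|->]; rewrite orbT.
(* The path into [x] continues over the deleted edge; any other continues with [Q s], whose first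
   vertex [s] is already there. *)
pose R s := if s == x then P x ++ Q y else P s ++ behead (Q s).
pose idx s := if s == x then y else s.
have idxS s : s \in x |: S -> idx s \in y |: S.
  rewrite /idx; case: (eqVneq s x) => [_ _|sx s1]; first by rewrite setU11.
  exact: QS.
have RPQ s v : v \in R s -> v \in P s \/ v \in Q (idx s).
  rewrite /R /idx; case: eqP => [->|_]; rewrite mem_cat => /orP[]; [by left|by right|by left|].
  by move/mem_behead; right.
exists (x |: S), R; split=> //.
- move=> s s1; have [a [q [EP aA pq lq]]] := Plast s s1.
  have [q' [EQ pq' lq']] := Qhead _ (idxS s s1).
  have m v : v \in P s -> v \in Q (idx s) -> v = s /\ v = idx s by apply: meet => //; apply: idxS.
  have uP := Pu s s1; have uQ := Qu _ (idxS s s1).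
  rewrite /R; move: EQ pq' lq' m uQ; rewrite /idx.
  case: (eqVneq s x) => [Es|sx] EQ pq' lq' m uQ.
    have dis : ~~ has (mem (P s)) (Q y).
      apply/hasPn => v vQ; apply/negP => /= vP.
      by have [E1 E2] := m v vP vQ; move: xy; rewrite -Es -E1 E2 eqxx.
    rewrite -Es cat_uniq uP uQ dis EP EQ /= cat_path last_cat /= aA (sub_path e'e pq).
    by rewrite lq Es exy (sub_path e'e pq') lq'.
  have dis : ~~ has (mem (P s)) (behead (Q s)).
    apply/hasPn => v vQ; apply/negP => /= vP.
    have [E1 _] := m v vP (mem_behead vQ).
    by move: uQ; rewrite EQ /= -E1 => /andP[/negP]; rewrite EQ /= in vQ.
  rewrite cat_uniq uP dis EP EQ /= cat_path last_cat /= aA (sub_path e'e pq) lq.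
  by rewrite (sub_path e'e pq') lq' /=; rewrite EQ /= in uQ; case/andP: uQ.
move=> s s' v s1 s1' /RPQ[] vs /RPQ[] vs'.
- exact: Pd vs vs'.
- have [E1 E2] := meet _ _ _ s1 (idxS _ s1') vs vs'.
  have : s = idx s' by rewrite -E1.
  rewrite /idx; case: eqP => // _ Ey; move: s1; rewrite Ey !inE eq_sym (negbTE xy).
  by rewrite (negbTE yS).
- have [E1 E2] := meet _ _ _ s1' (idxS _ s1) vs' vs.
  have : s' = idx s by rewrite -E1.
  rewrite /idx; case: eqP => // _ Ey; move: s1'; rewrite Ey !inE eq_sym (negbTE xy).
  by rewrite (negbTE yS).
have := Qd _ _ _ (idxS _ s1) (idxS _ s1') vs vs'.
rewrite /idx; case: eqP => [->|_]; case: eqP => [->|_] //.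
  by move=> E; move: s1'; rewrite -E !inE eq_sym (negbTE xy) (negbTE yS).
by move=> E; move: s1; rewrite E !inE eq_sym (negbTE xy) (negbTE yS).
Qed.

End Menger.

(** * Path systems leaving a cycle *)

Section Extensions.
Variables (G : sgraph) (x0 : G) (C H : seq G).
Hypothesis cH : is_cycle H.
Hypothesis HC : {in H, forall v, v \notin C}.
Local Notation t := (size H).
Local Notation u := (cnth x0 H).
Implicit Types (E : 'I_t -> seq G) (i j l : 'I_t) (w v : G) (s p q : seq G).

(* [E i] lists the vertices after [u i] of a path that leaves [H] at [u i]. *)
Definition extension E : Prop :=
  [/\ forall i, path (@adj G) (u i) (E i), forall i, uniq (E i),
      forall i v, v \in E i -> (v \notin H) && (v \notin C) &
      forall i j v, v \in E i -> v \in E j -> i = j].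

Definition tip E i : G := last (u i) (E i).

Lemma sum_size_extension E : uniq C -> extension E ->
  size C + t + \sum_i size (E i) <= #|G|.
Proof.
move=> uC [_ uE offE disE].
have uH : uniq H by case/and3P: cH.
have cnt s : uniq s -> size s = \sum_(v : G) (v \in s).
  by move=> us; rewrite -(card_uniqP us) -sum1_card big_mkcond.
have -> : \sum_i size (E i) = \sum_i \sum_v (v \in E i) by apply: eq_bigr => i _; apply: cnt.
rewrite (cnt C uC) [X in _ + X + _](cnt H uH).
rewrite exchange_big /= -!big_split /= -sum1_card; apply: leq_sum => v _.
have [/existsP[i vi]|] := boolP [exists i, v \in E i].
  have /andP[/negbTE-> /negbTE->] := offE _ _ vi.
  rewrite (bigD1 i) //= vi big1 // => j ji; apply/eqP; rewrite eqb0.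
  by apply/negP => /(disE i j v vi) Eij; rewrite Eij eqxx in ji.
rewrite negb_exists => /forallP nv; rewrite [X in _ + X]big1 ?addn0; last first.
  by move=> i _; rewrite (negbTE (nv i)).
by have [/HC/negbTE->|_] := boolP (v \in H); rewrite ?addn0 ?leq_b1.
Qed.

(** [E0] is the initial system: empty for the first bound, two links towards [C] for the second.
    There [act] holds the indices of the links, and [minE0] follows from their minimality. *)
Variables (E0 : 'I_t -> seq G) (act : pred 'I_t).
Hypothesis extE0 : extension E0.
Hypothesis actE0 : forall i, ~~ act i -> E0 i = [::].
Hypothesis minE0 : forall i l w, ~~ act i -> adj (u i) w -> w \in E0 l ->
  ohead (E0 l) = Some w.

Let S w := [exists l, w \in E0 l].
Let hdS w := [exists l, ohead (E0 l) == Some w].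

(* The vertices of [E0] stay at the start of the paths indexed by [act], so that
   all other paths avoid them; the third and fourth conditions make the class
   stable under moving the end of one path to a trivial one. *)
Definition reserving E : Prop :=
  [/\ forall w, S w -> exists2 l, act l & w \in E l,
      forall l w, ~~ act l -> w \in E l -> ~~ S w,
      forall l p w q, E l = p ++ w :: q -> ~~ S w -> {in q, forall v, ~~ S v} &
      forall l p w q, E l = p ++ w :: q -> p != [::] -> ~~ hdS w].

(** [N] exceeds the total size of the paths, so [phi] compares the number of nontrivial paths first
    and their total size second. *)
Let N := #|G|.+1.
Let F s := (s != [::]) * N + size s.
Let phi E := \sum_i F (E i).

Definition upd E i s : 'I_t -> seq G := fun l => if l == i then s else E l.

Lemma sum_upd E i s : phi (upd E i s) + F (E i) = phi E + F s.
Proof.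
rewrite /phi (bigD1 i) //= [in RHS](bigD1 i) //= /upd eqxx.
have -> : \sum_(l | l != i) F (if l == i then s else E l) = \sum_(l | l != i) F (E l).
  by apply: eq_bigr => l /negbTE ->.
by rewrite addnC -addnA; congr (_ + _); rewrite addnC.
Qed.

Lemma extension_upd E i s : extension E -> path (@adj G) (u i) s -> uniq s ->
  {in s, forall v, (v \notin H) && (v \notin C)} ->
  (forall j v, v \in s -> v \in E j -> j = i) -> extension (upd E i s).
Proof.
move=> [pE uE oE dE] ps us os ds; split; rewrite /upd.
- by move=> l; case: eqP => [->|].
- by move=> l; case: eqP.
- by move=> l v; case: eqP => [_ /os|_ /oE].
move=> l j v; case: eqP => [->|nl]; case: eqP => [->|nj] //.
- by move=> vs vj; rewrite (ds j v vs vj) in nj.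
- by move=> vl vs; rewrite (ds l v vs vl) in nl.
exact: dE.
Qed.

Lemma reserving_E0 : reserving E0.
Proof.
have [pE uE oE dE] := extE0.
split.
- move=> w /existsP[l wl]; exists l => //; apply/negPn/negP => /actE0 El.
  by rewrite El in wl.
- by move=> l w /actE0 ->.
- move=> l p w q El /existsPn/(_ l); rewrite El mem_cat mem_head orbT //.
move=> l p w q El p0; apply/negP => /existsP[j /eqP hj].
have wl : w \in E0 l by rewrite El mem_cat mem_head orbT.
have wj : w \in E0 j by case: (E0 j) hj => //= a r [->]; rewrite mem_head.
have Elj := dE _ _ _ wl wj; rewrite -Elj in hj.
have := uE l; rewrite El cat_uniq => /and3P[_ /hasPn/(_ w (mem_head _ _)) + _].
by case: p El p0 => // a p El _; rewrite El /= in hj *; case: hj => ->; rewrite inE eqxx.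
Qed.

Lemma exists_maximal_extension : uniq C -> exists E, [/\ extension E, reserving E &
  forall E', extension E' -> reserving E' -> phi E' <= phi E].
Proof.
move=> uC; have [] := @exists_max _ (fun E => extension E /\ reserving E) phi (t * N + #|G|).
- by exists E0; split=> //; apply: reserving_E0.
- move=> E [eE _]; rewrite /phi /F big_split /=; apply: leq_add; last first.
    by apply: leq_trans (sum_size_extension uC eE); apply: leq_addl.
  rewrite -big_distrl leq_mul2r; apply/orP; right.
  by rewrite -[leqRHS]card_ord -sum1_card; apply: leq_sum => i _; apply: leq_b1.
by move=> E [eE rE] mE; exists E; split=> // E' eE' rE'; apply: mE.
Qed.

Section Maximal.
Variable E : 'I_t -> seq G.
Hypotheses (eE : extension E) (rE : reserving E).
Hypothesis mE : forall E', extension E' -> reserving E' -> phi E' <= phi E.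

(** All reserved vertices lie on paths already, so [w] is unreserved and may be put last on any
    path. *)
Lemma reserving_append i w : (forall j, w \notin E j) ->
  reserving (upd E i (rcons (E i) w)).
Proof.
have [k1 k2 k3 k4] := rE; move=> wE.
have nS : ~~ S w by apply/negP => /k1[l _ wl]; have := wE l; rewrite wl.
split; rewrite /upd.
- move=> v /k1[l al vl]; exists l => //; case: eqP => // <-.
  by rewrite mem_rcons inE vl orbT.
- move=> l v al; case: eqP => [El|_]; last exact: k2.
  by rewrite mem_rcons inE => /orP[/eqP->//|]; apply: k2; rewrite -El.
- move=> l p v q; case: eqP => [_|_]; last exact: k3.
  case/lastP: q => [//|q b]; rewrite -rcons_cons -rcons_cat => /rcons_inj[Ei <-] nv.
  move=> z; rewrite mem_rcons inE => /orP[/eqP->//|]; exact: (k3 _ _ _ _ Ei nv).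
move=> l p v q; case: eqP => [_|_]; last exact: k4.
case/lastP: q => [|q b].
  rewrite cats1 => /rcons_inj[_ <-] _; apply: contra nS => /existsP[j /eqP hj].
  by apply/existsP; exists j; case: (E0 j) hj => //= a r [->]; rewrite mem_head.
rewrite -rcons_cons -rcons_cat => /rcons_inj[Ei _]; exact: (k4 _ _ _ _ Ei).
Qed.

Lemma maximal_tip_nbr i w : adj (tip E i) w -> w \notin H -> w \notin C ->
  exists j, w \in E j.
Proof.
have [pE uE oE dE] := eE; move=> iw wH wC.
apply: NNPP => nw; have wE j : w \notin E j by apply/negP => wj; apply: nw; exists j.
have : phi (upd E i (rcons (E i) w)) <= phi E.
  apply: mE (reserving_append i wE); apply: extension_upd => //.
  - by rewrite rcons_path pE.
  - by rewrite rcons_uniq wE uE.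
  - by move=> v; rewrite mem_rcons inE => /orP[/eqP->|/oE//]; rewrite wH.
  move=> j v; rewrite mem_rcons inE => /orP[/eqP-> wj|vi vj]; last exact: dE vj vi.
  by have := wE j; rewrite wj.
have := sum_upd E i (rcons (E i) w).
have : F (E i) < F (rcons (E i) w).
  by rewrite /F size_rcons; case: (E i) => [|a s] /=; rewrite ?mul1n ?mul0n; lia.
move: (phi E) (phi (upd _ _ _)) (F (E i)) (F _) => a b c d.
by lia.
Qed.

(** Otherwise [w] follows a nonempty part [p] of some [E l]. Moving [w] and everything after it to
    [E i] keeps the total size and makes one more path nontrivial. *)
Lemma maximal_trivial_nbr i w : E i = [::] -> adj (u i) w -> w \notin H -> w \notin C ->
  exists j q, E j = w :: q.
Proof.
have [pE uE oE dE] := eE; have [k1 k2 k3 k4] := rE; move=> Ei iw wH wC.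
have [l wl] : exists l, w \in E l by apply: (@maximal_tip_nbr i) => //; rewrite /tip Ei.
case/splitPr El : {1}(E l) / wl => [p q].
have [E1|p0] := eqVneq p [::]; first by exists l, q; rewrite El E1.
have li : l != i by apply/eqP => E1; rewrite E1 Ei in El; case: (p) El.
have wq : {subset w :: q <= E l} by move=> v vq; rewrite El mem_cat vq orbT.
have pl : {subset p <= E l} by move=> v vp; rewrite El mem_cat vp.
have uEl := uE l; rewrite El cat_uniq in uEl; case/and3P: uEl => up dpq uq.
(* A reserved [w] would by [minE0] be the first vertex of a path of [E0], and such a vertex never
   follows another one on a path. After an unreserved vertex come only unreserved ones. *)
have nSq : ~~ act i -> {in w :: q, forall v, ~~ S v}.
  move=> ai; have nS : ~~ S w.
    apply/negP => /existsP[j wj]; have := k4 _ _ _ _ El p0.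
    by move/existsPn/(_ j); rewrite (minE0 ai iw wj) eqxx.
  by move=> v; rewrite inE => /orP[/eqP->//|vq]; exact: (k3 _ _ _ _ El nS).
pose E1 := upd E l p.
have eE1 : extension E1.
  apply: extension_upd => //.
  - by have := pE l; rewrite El cat_path => /andP[].
  - by move=> v /pl /oE.
  by move=> j v /pl vl vj; apply: dE vj vl.
have eE2 : extension (upd E1 i (w :: q)).
  apply: extension_upd => //.
  - by have := pE l; rewrite El cat_path /= iw => /and3P[].
  - by move=> v /wq /oE.
  move=> j v vq; rewrite /E1 /upd; case: eqP => [->|jl] vj.
    by move/hasPn/(_ v vq): dpq; rewrite /= vj.
  by have := dE _ _ _ vj (wq _ vq).
have rE2 : reserving (upd E1 i (w :: q)).
  split; rewrite /E1 /upd.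
  - move=> v Sv; have [j aj vj] := k1 v Sv.
    have [Ej|jl] := eqVneq j l.
      rewrite Ej El mem_cat in vj; case/orP: vj => [vp|vq].
        by exists l; rewrite -?Ej // Ej (negbTE li) eqxx.
      exists i; last by rewrite eqxx.
      by apply/negPn/negP => /nSq/(_ v vq); rewrite Sv.
    have ji : j != i by apply/eqP => Ej; rewrite Ej Ei in vj.
    by exists j => //; rewrite (negbTE ji) (negbTE jl).
  - move=> j v aj; case: eqP => [Ej|_]; first by apply: nSq; rewrite -Ej.
    case: eqP => [Ej|_]; last exact: k2.
    by move/pl; apply: k2; rewrite -Ej.
  - move=> j r v r'; case: eqP => [_ Er|_].
      by apply: (k3 l (p ++ r)); rewrite El Er catA.
    case: eqP => [_ Er|_]; last exact: k3.
    move=> nv z zr'; apply: (k3 l r v (r' ++ w :: q)) => //; last by rewrite mem_cat zr'.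
    by rewrite El Er -catA.
  move=> j r v r'; case: eqP => [_ Er|_].
    move=> r0; apply: (k4 l (p ++ r) v r'); first by rewrite El Er catA.
    by case: (p) p0.
  case: eqP => [_ Er|_]; last exact: k4.
  by apply: (k4 l r v (r' ++ w :: q)); rewrite El Er -catA.
have := mE eE2 rE2; have := sum_upd E1 i (w :: q); have := sum_upd E l p.
have -> : E1 i = E i by rewrite /E1 /upd eq_sym (negbTE li).
rewrite -/E1 /F Ei El size_cat p0 /=.
have -> : p ++ w :: q != [::] by case: (p).
rewrite !mul1n mul0n !add0n; have : 0 < N by [].
move: (phi E) (phi E1) (phi (upd E1 i (w :: q))) (size p) (size q) N => a b c d e f.
by clear; lia.
Qed.

End Maximal.

Lemma exists_saturated_extension : uniq C -> exists E, [/\ extension E, reserving E,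
  forall i w, adj (tip E i) w -> w \notin H -> w \notin C -> exists j, w \in E j &
  forall i w, E i = [::] -> adj (u i) w -> w \notin H -> w \notin C ->
    exists j q, E j = w :: q].
Proof.
move=> uC; have [E [eE rE mE]] := exists_maximal_extension uC.
exists E; split=> //; first exact: maximal_tip_nbr.
exact: maximal_trivial_nbr.
Qed.

End Extensions.

(** * Neighbours of the tips *)

Section Walks.
Variable G : sgraph.
Implicit Types (x y z : G) (p q s : seq G).

Lemma walk_rev x y s : path (@adj G) x (rcons s y) -> path (@adj G) y (rcons (rev s) x).
Proof.
move=> pxy; have : path_between x y (x :: rcons s y) by rewrite /= eqxx pxy last_rcons eqxx.
by move/path_between_rev; rewrite rev_cons rev_rcons /= => /and3P[].
Qed.

Lemma walk_path_between x y s : s != [::] -> path (@adj G) x (rcons s y) ->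
  exists h k, [/\ adj x h, path_between h k s & adj k y].
Proof.
case: s => //= h s _ /andP[xh]; rewrite rcons_path => /andP[ps ly].
by exists h, (last h s); split=> //=; rewrite !eqxx ps.
Qed.

(** [D] runs from the last neighbour of [y] back to just after [x], so every neighbour other than
    [x] is on it. *)
Lemma count_nbrs_path x y s : path (@adj G) x s -> 0 < count (@adj G y) (x :: s) ->
  exists D, [/\ {subset D <= s}, uniq s -> uniq D, path (@adj G) y (rcons D x) &
                count (@adj G y) (x :: s) <= (size D).+1].
Proof.
elim/last_ind: s => [|s w IHs] /=.
  by rewrite addn0 => _; case yx: (adj y x) => // _; exists [::]; rewrite /= yx.
rewrite rcons_path => /andP[ps sw]; rewrite -cats1 count_cat /= addn0.
case yw: (adj y w) => /=; last first.
  rewrite addn0 => /(IHs ps)[D [sD uD pD le]]; exists D; split=> //.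
    by move=> v /sD; rewrite mem_cat => ->.
  by rewrite cat_uniq => /andP[/uD].
move=> _; exists (rev (s ++ [:: w])); split.
- by move=> v; rewrite mem_rev.
- by rewrite rev_uniq.
- rewrite -rev_cons cats1 -rcons_cons rev_rcons /= yw /=.
  have : path_between x w (x :: rcons s w) by rewrite /= eqxx rcons_path ps sw last_rcons eqxx.
  by move/path_between_rev; rewrite -rcons_cons rev_rcons /= => /and3P[].
rewrite size_rev size_cat /= addnA addn1 ltnS addn1.
exact: (count_size _ (x :: s)).
Qed.

End Walks.

Section CountingNeighbours.
Variables (G : sgraph) (x0 : G) (C H : seq G).
Hypothesis cH : is_cycle H.
Hypothesis HC : {in H, forall v, v \notin C}.
Hypothesis Hmax : forall D, is_cycle D -> {in D, forall v, v \notin C} -> size D <= size H.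
Local Notation t := (size H).
Local Notation u := (cnth x0 H).
Variable E : 'I_t -> seq G.
Hypothesis eE : extension x0 C E.
Hypothesis tipN : forall i w, adj (tip x0 E i) w -> w \notin H -> w \notin C ->
  exists j, w \in E j.
Hypothesis trivN : forall i w, E i = [::] -> adj (u i) w -> w \notin H -> w \notin C ->
  exists j q, E j = w :: q.
Implicit Types (i j l : 'I_t).
Local Notation tp := (tip x0 E).

Let t_gt0 : 0 < t := cycle_size_gt0 cH.
Definition omod n : 'I_t := Ordinal (ltn_pmod n t_gt0).

Lemma cnth_omod n : u (omod n) = u n.
Proof. by rewrite /cnth /= modn_mod. Qed.

Lemma omodDt n : omod (n + t) = omod n.
Proof. by apply: val_inj; rewrite /= modnDr. Qed.

Lemma omod_ord i : omod i = i.
Proof. by apply: val_inj; rewrite /= modn_small. Qed.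

Lemma cnth_ord_inj i j : u i = u j -> i = j.
Proof.
move=> Eu; apply: val_inj; apply: (cnth_inj_window cH (B := 0)) Eu;
  by rewrite add0n ltn_ord.
Qed.

Definition triv i := E i == [::].
(* Only meaningful when [E j] is nonempty. *)
Definition ext_head j := head (u j) (E j).
Definition cyc_degree i := #|[set l : 'I_t | adj (u i) (u l)]|.
Definition hits j l := count (@adj G (tp j)) (u l :: E l).
Definition outer_hits j := \sum_(l | l != j) hits j l.
Definition head_nbr j l := triv l && adj (u l) (ext_head j).
Definition head_nbrs j := #|[set l : 'I_t | head_nbr j l]|.
(* Up to [size (E i)], the neighbours of [tip i] outside [C]; the edges from
   trivial [u l] to the head of [E j] are charged to [j] instead of [l]. *)
Definition cost i := if triv i then cyc_degree i else outer_hits i + head_nbrs i.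
Definition attached i := #|[set z in C | adj (tp i) z]|.
Definition inner_degree i := #|[set w | adj (tp i) w & w \notin C]|.

Lemma nontriv_cons j : ~~ triv j -> exists q, E j = ext_head j :: q.
Proof. by rewrite /triv /ext_head; case: (E j) => //= a q _; exists q. Qed.

Lemma degree_tip i : degree (tp i) = attached i + inner_degree i.
Proof.
rewrite /degree /attached /inner_degree -(cardsID [set z in C]); congr (_ + _).
  by apply: eq_card => z; rewrite !inE andbC.
by apply: eq_card => z; rewrite !inE andbC.
Qed.

Lemma card_le_size (A : {set G}) (s : seq G) : {subset A <= s} -> #|A| <= size s.
Proof.
move=> As; apply: leq_trans (card_size s).
by apply: subset_leq_card; apply/subsetP.
Qed.

Lemma cyc_degree_lt i : cyc_degree i < t.
Proof.
rewrite -[ltnRHS]card_ord /cyc_degree -cardsT; apply: proper_card.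
by apply/properP; split; [apply: subsetT | exists i; rewrite !inE ?adj_irr].
Qed.

(** By [trivN], a neighbour of [u i] off [C] and [H] is the first vertex of some path. *)
Lemma inner_degree_triv i : triv i ->
  inner_degree i <= cyc_degree i + #|[set j : 'I_t | ~~ triv j && adj (u i) (ext_head j)]|.
Proof.
move=> /eqP Ei; pose A := [set l : 'I_t | adj (u i) (u l)].
pose B := [set j : 'I_t | ~~ triv j && adj (u i) (ext_head j)].
pose s := [seq u (nat_of_ord l) | l <- enum A] ++ [seq ext_head j | j <- enum B].
have <- : size s = cyc_degree i + #|B| by rewrite size_cat !size_map -!cardE.
apply: card_le_size => w; rewrite inE /tip Ei /= => /andP[iw wC].
rewrite mem_cat; have [wH|wH] := boolP (w \in H).
  have [n ltn Ew] := cnth_surj x0 wH.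
  apply/orP; left; apply/mapP; exists (omod n); rewrite ?cnth_omod //.
  by rewrite mem_enum inE cnth_omod -Ew.
have [j [q Ej]] := trivN Ei iw wH wC.
apply/orP; right; apply/mapP; exists j; rewrite /ext_head ?Ej //.
by rewrite mem_enum inE /triv /ext_head Ej /= iw.
Qed.

(** The list [u j :: E j] offers at most [size (E j)] neighbours, as the tip is not adjacent to
    itself. *)
Lemma inner_degree_nontriv j : ~~ triv j -> inner_degree j <= size (E j) + outer_hits j.
Proof.
move=> nj; have [pE uE oE dE] := eE.
pose L := [seq l <- enum 'I_t | l != j].
pose s := belast (u j) (E j) ++ flatten [seq filter (@adj G (tp j)) (u l :: E l) | l <- L].
have <- : size s = size (E j) + outer_hits j.
  rewrite size_cat size_belast size_flatten; congr (_ + _).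
  rewrite /shape -map_comp sumnE big_map /L big_filter big_enum_cond.
  by apply: eq_bigr => l _; rewrite /comp size_filter.
apply: card_le_size => w; rewrite inE => /andP[jw wC].
have [l wl] : exists l, w \in u l :: E l.
  have [wH|wH] := boolP (w \in H).
    have [n ltn Ew] := cnth_surj x0 wH.
    by exists (omod n); rewrite cnth_omod -Ew mem_head.
  by have [l wl] := tipN jw wH wC; exists l; rewrite inE wl orbT.
rewrite mem_cat; have [El|lj] := eqVneq l j.
  rewrite El lastI mem_rcons inE in wl; case/orP: wl => [/eqP Ew|->//].
  by rewrite Ew adj_irr in jw.
apply/orP; right; apply/flattenP.
exists (filter (@adj G (tp j)) (u l :: E l)); last by rewrite mem_filter jw.
by apply/mapP; exists l; rewrite // mem_filter lj mem_enum.
Qed.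

(** Edges from trivial [u i] to first vertices of paths are counted at [i] by the degree and at the
    path by [cost]; exchanging summations shows that the totals agree. *)
Lemma sum_degrees d : (forall v : G, d <= degree v) ->
  t * d <= \sum_i attached i + \sum_i size (E i) + \sum_i cost i.
Proof.
move=> dmin.
pose a i := #|[set j : 'I_t | ~~ triv j && adj (u i) (ext_head j)]|.
have Ea : \sum_(i | triv i) a i = \sum_(j | ~~ triv j) head_nbrs j.
  have cnt (P : pred 'I_t) : #|[set j : 'I_t | P j]| = \sum_j P j.
    by rewrite -sum1_card big_mkcond /=; apply: eq_bigr => j _; rewrite inE; case: (P j).
  rewrite (eq_bigr _ (fun i _ => cnt _)) [in RHS](eq_bigr _ (fun i _ => cnt _)).
  rewrite [LHS]big_mkcond [RHS]big_mkcond /=.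
  transitivity (\sum_(i < t) \sum_(j < t) (triv i && (~~ triv j && adj (u i) (ext_head j)))).
    by apply: eq_bigr => i _; case: (triv i) => //=; rewrite big1.
  rewrite exchange_big /=; apply: eq_bigr => j _; case: (triv j) => /=.
    by rewrite big1 // => i _; rewrite andbF.
  by apply: eq_bigr.
have leq_i i : d <= attached i + size (E i) + (if triv i then cyc_degree i + a i else outer_hits i).
  apply: leq_trans (dmin (tp i)) _; rewrite degree_tip -addnA leq_add2l.
  case: (boolP (triv i)) => ti; last exact: inner_degree_nontriv.
  by have /eqP -> := ti; apply: inner_degree_triv.
have -> : t * d = \sum_(i < t) d by rewrite sum_nat_const card_ord.
pose f i := attached i + size (E i) + (if triv i then cyc_degree i + a i else outer_hits i).
apply: (@leq_trans (\sum_i f i)); first by apply: leq_sum => i _; apply: leq_i.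
rewrite !big_split /= leq_add2l.
rewrite (bigID triv) /= [leqRHS](bigID triv) /=.
rewrite [X in X + _](eq_bigr (fun i => cyc_degree i + a i)); last by move=> i ->.
rewrite [X in _ + X](eq_bigr outer_hits); last by move=> i /negbTE ->.
rewrite [X in _ <= X + _](eq_bigr cyc_degree); last by rewrite /cost => i ->.
rewrite [X in _ <= _ + X](eq_bigr (fun i => outer_hits i + head_nbrs i)); last first.
  by rewrite /cost => i /negbTE->.
by rewrite !big_split /= Ea -addnA leq_add2l addnC.
Qed.

(* The edges counted by [cost j] that go to the index [l]; the value 2 at [j]
   itself is what the spacing of the other marks leaves room for. *)
Definition mark j l : nat := if l == j then 2 else head_nbr j l + hits j l.

Lemma sum_mark j : ~~ triv j -> \sum_(l | l != j) mark j l = outer_hits j + head_nbrs j.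
Proof.
move=> nj; rewrite (eq_bigr (fun l => head_nbr j l + hits j l)); last first.
  by rewrite /mark => l /negbTE->.
rewrite big_split /= addnC; congr (_ + _).
rewrite /head_nbrs -sum1_card [RHS]big_mkcond [LHS]big_mkcond /=; apply: eq_bigr => l _.
rewrite inE; case: eqP => [->|_] /=; last by case: (head_nbr j l).
by rewrite /head_nbr (negbTE nj).
Qed.

Lemma hit_walk j l : 0 < hits j l ->
  exists D, [/\ {subset D <= E l}, uniq D, path (@adj G) (tp j) (rcons D (u l)) &
                hits j l <= (size D).+1].
Proof.
have [pE uE oE dE] := eE.
by move=> /(count_nbrs_path (pE l))[D [sD uD pD le]]; exists D; split=> //; apply: uD.
Qed.

Lemma disjoint_ext j l (D D' : seq G) : j != l -> {subset D <= E j} -> {subset D' <= E l} ->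
  ~~ has (mem D) D'.
Proof.
have [pE uE oE dE] := eE; move=> jl sD sD'; apply/hasPn => v /sD' vl.
by apply/negP => /sD vj; rewrite (dE _ _ _ vj vl) eqxx in jl.
Qed.

Lemma last_ext j x : ~~ triv j -> last x (E j) = tp j.
Proof. by rewrite /triv /tip; case: (E j). Qed.

Lemma omod_dist i j : i != j -> exists2 d, 0 < d < t & omod (i + d) = j.
Proof.
move=> neq; have li := ltn_ord i; have lj := ltn_ord j.
have nv : (i : nat) != j by [].
have [lt|lt] : i < j \/ j < i by lia.
  by exists (j - i); [lia | rewrite subnKC ?(ltnW lt) // omod_ord].
exists (j + t - i); first by lia.
by rewrite subnKC; [rewrite omodDt omod_ord | lia].
Qed.

(** A positive index other than [j] is bounded by its distance to [j], so the separate bound [t] for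
    a full turn is asked at [j] only. *)
Lemma sum_spaced_ord (g : 'I_t -> nat) j : 0 < g j <= t ->
  (forall m d, 0 < d <= t -> omod m != omod (m + d) ->
    0 < g (omod m) -> 0 < g (omod (m + d)) -> maxn (g (omod m)) (g (omod (m + d))) <= d) ->
  \sum_l g l <= t.
Proof.
move=> gj sp; rewrite (eq_bigr (fun i : 'I_t => g (omod i))) => [|i _]; last by rewrite omod_ord.
apply: (@sum_spaced_cyclic (fun n => g (omod n))) => //.
  by move=> m; rewrite omodDt.
move=> m d hd m1 m2; have [Em|neq] := eqVneq (omod m) (omod (m + d)); last first.
  by have := sp _ _ hd neq m1 m2; rewrite geq_max => /andP[].
have -> : d = t.
  have /(congr1 val)/eqP := Em; rewrite /= -{1}[m]addn0 eqn_modDl mod0n => Ed.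
  have [ltd|//] : d < t \/ d = t by lia.
  by rewrite modn_small // in Ed; lia.
have [->|nej] := eqVneq (omod m) j; first by case/andP: gj.
have [d' hd' Ed'] := omod_dist nej; rewrite -(omod_ord (omod m)) in m1.
have mj : 0 < g (omod (omod m + d')) by rewrite Ed'; case/andP: gj.
have neq : omod (omod m) != omod (omod m + d') by rewrite Ed' omod_ord.
have hd2 : 0 < d' <= t by lia.
by have := sp _ _ hd2 neq m1 mj; rewrite geq_max omod_ord => /andP[le _]; lia.
Qed.

Section Connections.
Variable j : 'I_t.
Hypothesis nj : ~~ triv j.
(** From [u l] with such an [l] the whole of [E j] can be traversed up to its tip. *)
Let isQ l := (l == j) || head_nbr j l.

Let Q_walk l : isQ l -> path (@adj G) (u l) (E j).
Proof.
have [pE _ _ _] := eE; case/orP => [/eqP->//|/andP[_ lj]].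
by have [q Ej] := nontriv_cons nj; have := pE j; rewrite Ej /= lj => /andP[].
Qed.

Let Q_mark l : isQ l -> mark j l <= 2.
Proof.
rewrite /isQ /mark; case: eqP => //= _ hl; rewrite hl; case/andP: hl => /eqP El _.
by rewrite /hits El /= addn0; case: (adj _ _).
Qed.

Let nQ_mark l : ~~ isQ l -> l != j /\ mark j l = hits j l.
Proof. by rewrite /isQ /mark negb_or => /andP[lj /negbTE->]; rewrite (negbTE lj). Qed.

Lemma hit_hit_walk l l' : l != j -> l' != j -> l != l' -> 0 < hits j l -> 0 < hits j l' ->
  exists s, [/\ s != [::], path (@adj G) (u l) (rcons s (u l')), uniq s,
  {in s, forall v, [|| v \in E j, v \in E l | v \in E l']} &
  maxn (hits j l) (hits j l') <= (size s).+1].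
Proof.
have [pE uE oE dE] := eE; move=> lj l'j ll' ml ml'.
have [D [sD uD pD le]] := hit_walk ml; have [D' [sD' uD' pD' le']] := hit_walk ml'.
have tj : tp j \in E j.
  by have [q Ej] := nontriv_cons nj; rewrite /tip Ej /= mem_last.
exists (rev D ++ tp j :: D'); split.
- by case: (rev D).
- rewrite rcons_cat rcons_cons -cat_rcons cat_path last_rcons pD' andbT.
  exact: walk_rev.
- rewrite cat_uniq rev_uniq uD /= uD' andbT; apply/andP; split.
  + rewrite mem_rev negb_or; apply/andP; split.
      by apply/negP => /sD /(dE _ _ _ tj) Ejl; rewrite Ejl eqxx in lj.
    have : ~~ has (mem D) D' by apply: disjoint_ext ll' sD sD'.
    by move=> /hasPn nD; apply/hasPn => v /nD; rewrite /= mem_rev.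
  by apply/negP => /sD' /(dE _ _ _ tj) Ejl; rewrite Ejl eqxx in l'j.
- move=> v; rewrite mem_cat mem_rev inE => /or3P[/sD->|/eqP->|/sD'->]; rewrite ?orbT //.
  by rewrite tj.
rewrite size_cat size_rev /= geq_max; apply/andP; split.
  by apply: leq_trans le _; rewrite ltnS leq_addr.
by apply: leq_trans le' (leqW _); rewrite leq_addl.
Qed.

Let conn l l' s := [/\ s != [::], path (@adj G) (u l) (rcons s (u l')), uniq s,
  {in s, forall v, [|| v \in E j, v \in E l | v \in E l']} &
  maxn (mark j l) (mark j l') <= (size s).+1].

Let conn_Q_nQ l l' : isQ l -> ~~ isQ l' -> 0 < mark j l' -> exists s, conn l l' s.
Proof.
have [pE uE oE dE] := eE; move=> Ql nQl'; have [l'j El'] := nQ_mark nQl'; rewrite El'.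
move=> /hit_walk[D [sD uD pD le]]; exists (E j ++ D); split.
- by have [q ->] := nontriv_cons nj.
- by rewrite rcons_cat cat_path (Q_walk Ql) /= (last_ext _ nj).
- rewrite cat_uniq uE uD andbT /=.
  by apply: (disjoint_ext (j := j) (l := l')) sD => //; rewrite eq_sym.
- by move=> v; rewrite mem_cat => /orP[->//|/sD->]; rewrite !orbT.
have sj : 0 < size (E j) by have [q ->] := nontriv_cons nj.
have := Q_mark Ql; rewrite El' size_cat geq_max => ml; apply/andP; split.
  by apply: leq_trans ml _; rewrite ltnS (leq_trans sj) ?leq_addr.
by apply: leq_trans le _; rewrite ltnS leq_addl.
Qed.

(** Two indices in [isQ] are joined through [ext_head j] alone, a mixed pair through all of [E j],
    and two others through the tip of [E j]. *)
Lemma connection l l' : l != l' -> 0 < mark j l -> 0 < mark j l' -> exists s, conn l l' s.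
Proof.
have [pE uE oE dE] := eE; move=> ll' ml ml'.
have [Ql|Ql] := boolP (isQ l); have [Ql'|Ql'] := boolP (isQ l').
- have [q Ej] := nontriv_cons nj; exists [:: ext_head j]; split=> //=.
  + have := Q_walk Ql; have := Q_walk Ql'; rewrite Ej /= => /andP[a' _] /andP[-> _].
    by rewrite adj_sym a'.
  + by move=> v; rewrite inE => /eqP->; rewrite Ej mem_head.
  by rewrite geq_max !Q_mark.
- exact: conn_Q_nQ.
- have [s [s0 ps us sE le]] := conn_Q_nQ Ql' Ql ml; exists (rev s); split.
  + by rewrite -size_eq0 size_rev size_eq0.
  + exact: walk_rev.
  + by rewrite rev_uniq.
  + by move=> v; rewrite mem_rev => /sE; rewrite [(v \in E l') || _]orbC.
  by rewrite size_rev maxnC.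
have [lj El] := nQ_mark Ql; have [l'j El'] := nQ_mark Ql'.
by rewrite /conn El El'; apply: hit_hit_walk; rewrite -?El -?El'.
Qed.

Lemma mark_spacing m d : 0 < d <= t -> omod m != omod (m + d) ->
  0 < mark j (omod m) -> 0 < mark j (omod (m + d)) ->
  maxn (mark j (omod m)) (mark j (omod (m + d))) <= d.
Proof.
have [pE uE oE dE] := eE; move=> hd neq m1 m2.
have [s [s0 ps us sE le]] := connection neq m1 m2.
apply: leq_trans le _.
have [h [k [mh pb km]]] := walk_path_between s0 ps; rewrite !cnth_omod in mh km.
apply: (@detour_size _ x0 H cH (mem C) m d h k s) => // v /sE /or3P[]; exact: oE.
Qed.

(** If [H] were a single vertex, it would form with the first vertex of [E j] a longer cycle off
    [C]. *)
Lemma two_le_cycle : 2 <= t.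
Proof.
have [pE uE oE dE] := eE; have [q Ej] := nontriv_cons nj.
have ij : adj (u j) (ext_head j) by have := pE j; rewrite {1}Ej /= => /andP[].
apply: (@detour_size _ x0 H cH (mem C) j t (ext_head j) (ext_head j) [:: ext_head j]) => //.
- by rewrite leqnn t_gt0.
- exact: path_between_seq1.
- by rewrite cnth_addt adj_sym.
by move=> v; rewrite inE => /eqP->; apply: (oE j); rewrite Ej mem_head.
Qed.

Lemma cost_nontriv_le : outer_hits j + head_nbrs j + 2 <= t.
Proof.
rewrite -sum_mark // addnC.
have -> : 2 + \sum_(l | l != j) mark j l = \sum_l mark j l.
  by rewrite [RHS](bigD1 j) //= {2}/mark eqxx.
apply: (@sum_spaced_ord (mark j) j); rewrite ?{1}/mark ?eqxx ?two_le_cycle //.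
by move=> m d; apply: mark_spacing.
Qed.

(** Here [j] carries the weight of its whole path, since detours from [u j] are led through all of
    [E j]. *)
Let deep l := if l == j then (size (E j)).+1 else hits j l.

Let deep_connection l l' : l != l' -> 0 < deep l -> 0 < deep l' -> exists s,
  [/\ s != [::], path (@adj G) (u l) (rcons s (u l')), uniq s,
  {in s, forall v, [|| v \in E j, v \in E l | v \in E l']} &
  maxn (deep l) (deep l') <= (size s).+1].
Proof.
have [pE uE oE dE] := eE.
have tj : tp j \in E j.
  by have [q Ej] := nontriv_cons nj; rewrite /tip Ej /= mem_last.
have fromj i : i != j -> 0 < hits j i -> exists s,
  [/\ s != [::], path (@adj G) (u j) (rcons s (u i)), uniq s,
  {in s, forall v, (v \in E j) || (v \in E i)} &
  maxn (size (E j)).+1 (hits j i) <= (size s).+1].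
  move=> ij /hit_walk[D [sD uD pD le]]; exists (E j ++ D); split.
  - by have [q ->] := nontriv_cons nj.
  - by rewrite rcons_cat cat_path pE.
  - rewrite cat_uniq uE uD andbT /=.
    by apply: (disjoint_ext (j := j) (l := i)) sD => //; rewrite eq_sym.
  - by move=> v; rewrite mem_cat => /orP[->//|/sD->]; rewrite orbT.
  rewrite size_cat geq_max ltnS leq_addr (leq_trans le) //.
  by rewrite ltnS leq_addl.
rewrite /deep; case: (eqVneq l j) => [->|lj]; case: (eqVneq l' j) => [->|l'j] // ll' d1 d2.
- have [s [s0 ps us sE le]] := fromj l' l'j d2; exists s; split=> // v /sE /orP[->//|->].
  by rewrite !orbT.
- have [s [s0 ps us sE le]] := fromj l lj d1; exists (rev s); split.
  + by rewrite -size_eq0 size_rev size_eq0.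
  + exact: walk_rev.
  + by rewrite rev_uniq.
  + by move=> v; rewrite mem_rev => /sE /orP[->//|->]; rewrite orbT.
  by rewrite size_rev maxnC.
exact: hit_hit_walk.
Qed.

(** If the tip has a neighbour on another [u l :: E l], the spaced weights [deep] add up to at most
    [t]. Otherwise all its neighbours off [C] lie on [u j :: E j], and the segment from the first of
    them to the tip closes to a cycle containing them and the tip. *)
Lemma inner_degree_nontriv_lt : inner_degree j < t.
Proof.
have [pE uE oE dE] := eE.
have [o0|o0] := posnP (outer_hits j); last first.
  apply: leq_ltn_trans (inner_degree_nontriv nj) _.
  have -> : (size (E j) + outer_hits j).+1 = \sum_l deep l.
    rewrite [RHS](bigD1 j) //= {1}/deep eqxx addSn; congr (_ + _).+1.
    by apply: eq_bigr => l /negbTE lj; rewrite /deep lj.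
  have sp m d : 0 < d <= t -> omod m != omod (m + d) ->
      0 < deep (omod m) -> 0 < deep (omod (m + d)) ->
      maxn (deep (omod m)) (deep (omod (m + d))) <= d.
    move=> hd neq m1 m2.
    have [s [s0 ps us sE le]] := deep_connection neq m1 m2.
    apply: leq_trans le _.
    have [h [k [mh pb km]]] := walk_path_between s0 ps; rewrite !cnth_omod in mh km.
    apply: (@detour_size _ x0 H cH (mem C) m d h k s) => // v /sE /or3P[]; exact: oE.
  apply: (@sum_spaced_ord deep j) => //; rewrite ?{1}/deep ?eqxx //=.
  (* A second positive index bounds the weight at [j] by a distance; it exists because
     [outer_hits j] is positive. *)
  have [/existsP[l /andP[lj hl]]|] := boolP [exists l : 'I_t, (l != j) && (0 < hits j l)].
    have [d hd Ed] := omod_dist lj.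
    have dj : 0 < deep (omod (l + d)) by rewrite Ed /deep eqxx.
    have dl : 0 < deep (omod l) by rewrite omod_ord /deep (negbTE lj).
    have neq : omod l != omod (l + d) by rewrite Ed omod_ord.
    have hd' : 0 < d <= t by lia.
    by have := sp _ _ hd' neq dl dj; rewrite Ed {2}/deep eqxx geq_max => /andP[_ ?]; lia.
  rewrite negb_exists => /forallP nh; move: o0; rewrite /outer_hits big1 // => l lj.
  by apply/eqP; rewrite -leqn0 leqNgt; have := nh l; rewrite lj.
pose s := u j :: E j.
have subs : {subset [set w | adj (tp j) w & w \notin C] <= s}.
  move=> w; rewrite inE => /andP[jw wC].
  have out0 l : l != j -> w \notin u l :: E l.
    move=> lj; apply/negP => wl; move: o0; apply/eqP; rewrite -lt0n.
    rewrite /outer_hits (bigD1 l) //= addn_gt0; apply/orP; left.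
    by rewrite -has_count; apply/hasP; exists w.
  have [l wl] : exists l, w \in u l :: E l.
    have [wH|wH] := boolP (w \in H).
      have [n ltn Ew] := cnth_surj x0 wH.
      by exists (omod n); rewrite cnth_omod -Ew mem_head.
    by have [l wl] := tipN jw wH wC; exists l; rewrite inE wl orbT.
  have [El|lj] := eqVneq l j; first by rewrite /s -El.
  by have := out0 l lj; rewrite wl.
have [/hasP[w ws jw]|] := boolP (has (@adj G (tp j)) s); last first.
  move=> /hasPn n0; rewrite /inner_degree; apply: leq_ltn_trans t_gt0.
  rewrite leqn0 cards_eq0 -subset0; apply/subsetP => w wA.
  by have := n0 w (subs w wA); move: wA; rewrite !inE => /andP[->].
have us : uniq s.
  rewrite /= uE andbT; apply/negP => /oE /andP[/negP[]]; exact: cnth_in.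
have sC : {in s, forall v, v \notin C}.
  by move=> v; rewrite inE => /orP[/eqP->|/oE/andP[]//]; apply/HC/cnth_in.
have [p1 [a [p2 [Es ja np1]]]] : exists p1 a p2,
    [/\ s = p1 ++ a :: p2, adj (tp j) a & ~~ has (@adj G (tp j)) p1].
  have hs : has (@adj G (tp j)) s by apply/hasP; exists w.
  case/split_find: hs => a p1 p2 ja np1.
  by exists p1, a, p2; rewrite cat_rcons.
have la : last a p2 = tp j.
  have -> : tp j = last (u j) s by [].
  by rewrite Es last_cat.
have pa : path (@adj G) a p2.
  have : path (@adj G) (u j) (E j) by apply: pE.
  move: Es; rewrite /s; case: p1 {np1} => [[<- <-]//|b p1 [_ ->]].
  by rewrite cat_path /= => /and3P[].
have cD : is_cycle (a :: p2).
  apply/and3P; split=> //; first by move: us; rewrite Es cat_uniq => /and3P[].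
  by rewrite /= rcons_path pa la ja orbT.
apply: leq_trans (Hmax cD _); last first.
  by move=> v va; apply: sC; rewrite Es mem_cat va orbT.
rewrite /= ltnS -(size_belast a); apply: card_le_size => v vA.
have := subs v vA; move: vA; rewrite inE => /andP[jv _]; rewrite Es mem_cat.
case/orP=> [vp1|]; first by move/hasPn/(_ v vp1): np1; rewrite jv.
rewrite lastI la mem_rcons inE => /orP[/eqP Ev|//].
by rewrite Ev adj_irr in jv.
Qed.

End Connections.

Lemma exists_inner_degree_lt : exists i, inner_degree i < t.
Proof.
have [/existsP[j nj]|] := boolP [exists j, ~~ triv j].
  by exists j; apply: inner_degree_nontriv_lt.
rewrite negb_exists => /forallP allT; pose i := omod 0; exists i.
apply: leq_ltn_trans (inner_degree_triv _) _; first by apply/negPn/allT.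
have -> : [set j : 'I_t | ~~ triv j && adj (u i) (ext_head j)] = set0.
  by apply/setP => j; rewrite !inE (negbTE (allT j)).
rewrite cards0 addn0; apply: cyc_degree_lt.
Qed.

Lemma cost_lt i : cost i < t.
Proof.
rewrite /cost; case: (boolP (triv i)) => ti; first exact: cyc_degree_lt.
by have := cost_nontriv_le ti; lia.
Qed.
End CountingNeighbours.

(** * Labels on the longest cycle *)

Lemma path_between_ext (G : sgraph) (x y : G) s s' p :
  path (@adj G) x s -> path (@adj G) y s' -> path_between x y p ->
  path_between (last x s) (last y s') (rev s ++ p ++ s').
Proof.
have right (a b : G) q r : path (@adj G) b r -> path_between a b q ->
    path_between a (last b r) (q ++ r).
  move=> pr; case: q => //= c q /and3P[-> pq /eqP lq].
  by rewrite cat_path pq lq pr last_cat lq eqxx.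
move=> ps ps' pp; have /path_between_rev := right _ _ _ _ ps' pp.
by move/(right _ _ _ _ ps)/path_between_rev; rewrite rev_cat revK.
Qed.

Section Labels.
Variables (G : sgraph) (x0 : G) (C H : seq G).
Hypothesis lC : longest_cycle C.
Hypothesis cH : is_cycle H.
Hypothesis HC : {in H, forall v, v \notin C}.
Local Notation t := (size H).
Local Notation u := (cnth x0 H).
Variable E : 'I_t -> seq G.
Hypothesis eE : extension x0 C E.
Local Notation tp := (tip x0 E).
Local Notation omod := (omod cH).

Definition labels z := [set i : 'I_t | adj (tp i) z].

(** Forward distances from [j] to the elements of [S] are distinct, so the largest is at least
    [#|S|.-1]. *)
Lemma far_label (S : {set 'I_t}) (j : 'I_t) : 0 < #|S| ->
  exists2 i, i \in S & (i = j /\ #|S| <= 1) \/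
    exists2 d, 0 < d < t & omod (j + d) = i /\ #|S| <= d.+1.
Proof.
move=> S0; have [S1|] := boolP ((j \in S) && (#|S| <= 1)).
  by case/andP: S1 => jS S1; exists j => //; left.
move=> nS; apply: NNPP => Hno.
pose f (i : 'I_t) := (i + t - j) %% t.
have fP i : i != j -> 0 < f i < t /\ omod (j + f i) = i.
  move=> ij; have li := ltn_ord i; have lj := ltn_ord j.
  have nv : (i : nat) != j by [].
  rewrite /f; have [lt|lt] : i < j \/ j < i by lia.
    rewrite modn_small; last by lia.
    split; first by lia.
    by rewrite subnKC; [rewrite omodDt omod_ord | lia].
  have -> : i + t - j = (i - j) + t by lia.
  rewrite modnDr modn_small; last by lia.
  by split; [lia | rewrite subnKC ?(ltnW lt) // omod_ord].
have fS i : i \in S -> i != j -> f i < #|S|.-1.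
  move=> iS ij; have [f1 f2] := fP i ij; rewrite ltnNge; apply/negP => le.
  by apply: Hno; exists i => //; right; exists (f i); rewrite // f2; split=> //; lia.
have : size [seq f i | i <- enum (S :\ j)] <= size (iota 1 #|S|.-2).
  apply: uniq_leq_size.
    rewrite map_inj_in_uniq ?enum_uniq // => i i'; rewrite !mem_enum !inE.
    move=> /andP[ij _] /andP[i'j _] Ef.
    by rewrite -(proj2 (fP i ij)) Ef (proj2 (fP i' i'j)).
  move=> _ /mapP[i + ->]; rewrite mem_enum !inE => /andP[ij iS].
  by rewrite mem_iota; have := fS i iS ij; have [f1 _] := fP i ij; lia.
rewrite size_map -cardE size_iota; have := cardsD1 j S.
have [i iS] : exists i, i \in S by apply/card_gt0P.
have := fS i iS; move: nS S0; set n := #|S|; set m := #|S :\ j|.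
case: (boolP (j \in S)) => jS /= nS S0; last first.
  have ij : i != j by apply: contraNneq jS => <-.
  by move/(_ ij); lia.
by lia.
Qed.

(** Fix a label [j] of [z'] and a label [i] of [z] far from it. The walk enters at the tip of [i],
    descends to [u i], follows [H] back to [u j] and leaves through the tip of [j]; the arc of [H]
    alone is long enough. If [j] is the only label of [z], its tip suffices. *)
Lemma label_walk z z' : z \in C -> z' \in C -> 0 < #|labels z| -> 0 < #|labels z'| ->
  exists h k s, [/\ adj z h, path_between h k s, adj k z', uniq s &
    {in s, forall v, v \notin C} /\ #|labels z| <= size s].
Proof.
have [pE uE oE dE] := eE.
move=> zC z'C Sz /card_gt0P[j]; rewrite inE => jz'.
have tipC i : tp i \notin C.
  rewrite /tip; case/lastP: (E i) (oE i) => [_|s w oi]; first by apply/HC/cnth_in.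
  rewrite last_rcons; have /andP[] // : (w \notin H) && (w \notin C).
  by apply: oi; rewrite mem_rcons mem_head.
have [i iS [[Ei S1]|[d hd [Ed Sd]]]] := far_label j Sz; rewrite inE in iS.
  exists (tp j), (tp j), [:: tp j]; split=> //.
  - by rewrite adj_sym -Ei.
  - exact: path_between_seq1.
  by split=> // v; rewrite inE => /eqP->.
have [ps [Eps ups psP sps]] : exists ps, [/\ ps = rev (iota j d.+1), uniq ps,
    forall m, m \in ps -> j <= m < j + t & size ps = d.+1].
  exists (rev (iota j d.+1)); split; rewrite ?rev_uniq ?iota_uniq ?size_rev ?size_iota //.
  by move=> m; rewrite mem_rev mem_iota; lia.
have Hseg : path_between (u i) (u j) [seq u m | m <- ps].
  rewrite Eps.
  have -> : d.+1 = (j + d).+1 - j by lia.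
  rewrite -Ed cnth_omod; apply: path_between_cnth_rev => //; lia.
have ij : i != j.
  apply/eqP => Eij; have /(congr1 val)/eqP := Ed; rewrite /= Eij.
  rewrite -{2}(modn_small (ltn_ord j)) -{2}[val j]addn0 eqn_modDl mod0n modn_small; lia.
exists (tp i), (tp j), (rev (E i) ++ [seq u m | m <- ps] ++ E j); split=> //.
- by rewrite adj_sym.
- exact: path_between_ext.
- have segH v : v \in [seq u m | m <- ps] -> v \in H.
    by move=> /mapP[m _ ->]; apply: cnth_in.
  rewrite cat_uniq rev_uniq uE /= has_cat negb_or cat_uniq uE andbT.
  rewrite (@uniq_map_cnth _ x0 H cH j) //=.
  apply/andP; split; first (apply/andP; split).
  + apply/hasPn => v /segH vH; rewrite /= mem_rev; apply/negP => /oE.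
    by rewrite vH.
  + apply/hasPn => v vj; rewrite /= mem_rev; apply/negP => vi.
    by rewrite (dE _ _ _ vi vj) eqxx in ij.
  by apply/hasPn => v /oE /andP[vH _]; apply/negP => /segH; rewrite (negbTE vH).
split.
  move=> v; rewrite !mem_cat mem_rev => /or3P[/oE/andP[]//| |/oE/andP[]//].
  by move=> /mapP[m _ ->]; apply/HC/cnth_in.
apply: leq_trans Sd _; by rewrite !size_cat size_map sps addnCA leq_addr.
Qed.

(** The extra 1 per labelled vertex arises because a gap has one edge more than the walk that it
    must outmatch has vertices. *)
Lemma sum_labels : \sum_(z in C) (#|labels z| + (0 < #|labels z|)) <= size C.
Proof.
have [cC maxC] := lC.
apply: (sum_gaps x0) => //.
  move=> z zC Wz; have Sz : 0 < #|labels z| by case: #|labels z| Wz.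
  have [h [k [s [zh ps kz us [sC le]]]]] := label_walk zC zC Sz Sz.
  have [n ltn Ez] := cnth_surj x0 zC.
  apply: leq_trans (_ : (size s).+1 <= _); first by rewrite Sz addn1 ltnS.
  apply: (@detour_size _ x0 C cC pred0 n (size C) h k s) => //.
  - by move=> D cD _; apply: maxC.
  - by rewrite leqnn (cycle_size_gt0 cC).
  - by rewrite -Ez.
  - by rewrite cnth_addt -Ez.
  by move=> v /sC ->.
move=> z z' zC z'C _ Wz Wz'.
have Sz : 0 < #|labels z| by case: #|labels z| Wz.
have Sz' : 0 < #|labels z'| by case: #|labels z'| Wz'.
have [h [k [s [zh ps kz us [sC le]]]]] := label_walk zC z'C Sz Sz'.
by exists h, k, s; split=> //; split=> //; rewrite Sz addn1 ltnS.
Qed.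

Lemma sum_attachedE : \sum_i attached x0 C E i = \sum_(z in C) #|labels z|.
Proof.
have cnt (T : finType) (P : pred T) : #|[set x | P x]| = \sum_x P x.
  by rewrite -sum1_card big_mkcond /=; apply: eq_bigr => x _; rewrite inE; case: (P x).
rewrite (eq_bigr _ (fun i _ => cnt _ _)) exchange_big /= [RHS]big_mkcond /=.
apply: eq_bigr => z _; rewrite /labels cnt; case: (z \in C) => //=.
by rewrite big1.
Qed.

(** Every neighbour of the tip of [i0] on [C] is labelled and contributes the extra 1 of
    [sum_labels]. *)
Lemma sum_attached_add i0 : \sum_i attached x0 C E i + attached x0 C E i0 <= size C.
Proof.
apply: leq_trans sum_labels; rewrite big_split /= sum_attachedE leq_add2l.
rewrite /attached -sum1_card [leqLHS]big_mkcond [leqRHS]big_mkcond; apply: leq_sum => z _.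
rewrite inE; case: (z \in C) => //=; case: (boolP (adj _ z)) => // az.
by rewrite lt0b; apply/card_gt0P; exists i0; rewrite inE.
Qed.

Lemma sum_attached_lt : \sum_i attached x0 C E i < size C.
Proof.
have [cC _] := lC; have c0 := cycle_size_gt0 cC.
have [/eqP S0|S0] := boolP (\sum_i attached x0 C E i == 0); first by rewrite S0.
have [i ai] : exists i, 0 < attached x0 C E i.
  apply: NNPP => nex; case/negP: S0; rewrite sum_nat_eq0; apply/forallP => i.
  by rewrite -leqn0 leqNgt; apply/negP => ai; apply: nex; exists i.
by apply: leq_trans (sum_attached_add i); rewrite -addn1 leq_add2l.
Qed.

End Labels.

(** * The order of the graph when the outside cycle has at most [d] vertices *)

Section FirstBound.
Variables (G : sgraph) (C H : seq G) (d : nat).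
Hypothesis lC : longest_cycle C.
Hypothesis cH : is_cycle H.
Hypothesis HC : {in H, forall v, v \notin C}.
Hypothesis Hmax : forall D, is_cycle D -> {in D, forall v, v \notin C} -> size D <= size H.
Hypothesis degd : forall v : G, d <= degree v.

(** Start from the empty system. Some tip has fewer than [t = size H] neighbours off [C], hence at
    least [d - t + 1] on [C], which count twice. With every cost at most [t - 1] this gives
    [t * (d - t + 1) + d + 1 <= #|G|], the claim rearranged. *)
Lemma order_lower_bound : size H <= d -> (size H).+1 * (d - size H + 2) <= #|G|.+1.
Proof.
move=> td; have [x0 _] : exists x, x \in H.
  by case: (H) cH => // x s _; exists x; rewrite mem_head.
have uC : uniq C by case: lC => /and3P[].
pose E0 := fun _ : 'I_(size H) => [::] : seq G.
have eE0 : extension x0 C E0 by split.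
have [|//|E [eE _ tipN trivN]] :=
  @exists_saturated_extension G x0 C H cH HC E0 pred0 eE0 _ _ uC; first by [].
have sE := sum_size_extension cH HC uC eE.
have sd := sum_degrees cH eE tipN trivN degd.
have [i0 bi] := exists_inner_degree_lt cH HC Hmax eE tipN trivN.
have sa := sum_attached_add lC cH HC eE i0.
have di : d <= attached x0 C E i0 + inner_degree x0 C E i0 by rewrite -degree_tip.
have sc : \sum_i cost x0 E i <= size H * (size H).-1.
  rewrite -[X in X * _]card_ord -sum_nat_const; apply: leq_sum => i _.
  by have := cost_lt cH HC Hmax eE i; lia.
move: sE sd sa di sc bi; move: (\sum_i size (E i)) (\sum_i attached x0 C E i) (\sum_i cost x0 E i).
move: (attached x0 C E i0) (inner_degree x0 C E i0) (size C) (cycle_size_gt0 cH) td => a b c.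
move: (size H) => t t0 td e s f sE sd sa di sc bi.
have [m Em] : exists m, d = m + t.-1 by exists (d - t.-1); lia.
have -> : d - t + 2 = m.+1 by lia.
have : t * m + t * t.-1 <= s + e + f by rewrite -mulnDr -Em.
by move=> ?; rewrite mulSn mulnS; lia.
Qed.

End FirstBound.

(** * Two vertices of the cycle joined by short paths only *)

Lemma support_span (g : nat -> nat) a b : 0 < \sum_(a <= i < b) g i ->
  exists lo hi, [/\ a <= lo <= hi, hi < b, 0 < g lo, 0 < g hi &
    forall i, a <= i < b -> 0 < g i -> lo <= i <= hi].
Proof.
move=> S0; pose P i := (a <= i < b) && (0 < g i).
have exP : exists i, P i.
  apply: NNPP => nex; suff E : \sum_(a <= i < b) g i = 0 by rewrite E in S0.
  rewrite big_nat_cond big1 // => i /andP[hi _]; apply/eqP; rewrite -leqn0 leqNgt.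
  by apply/negP => gi; apply: nex; exists i; rewrite /P hi.
have bP i : P i -> i <= b by rewrite /P; lia.
case: (ex_minnP exP) => lo /andP[lo1 lo2] lomin.
case: (ex_maxnP exP bP) => hi /andP[hi1 hi2] himax.
have := lomin hi; rewrite /P hi1 hi2 => /(_ isT) lohi.
exists lo, hi; split=> //; try lia.
move=> i hi' gi; have Pi : P i by rewrite /P hi' gi.
by rewrite lomin // himax.
Qed.

Lemma sum_support (g : nat -> nat) a b lo hi : a <= lo -> lo <= hi.+1 -> hi < b ->
  (forall i, a <= i < b -> 0 < g i -> lo <= i <= hi) ->
  \sum_(a <= i < b) g i = \sum_(lo <= i < hi.+1) g i.
Proof.
move=> alo lohi hib gP.
have g0 i : a <= i < b -> ~~ (lo <= i <= hi) -> g i = 0.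
  by move=> hi' nin; apply/eqP; rewrite -leqn0 leqNgt; apply: contra nin; apply: gP.
have z1 : \sum_(a <= i < lo) g i = 0.
  by rewrite big_nat_cond big1 // => i /andP[hi' _]; apply: g0; lia.
have z2 : \sum_(hi.+1 <= i < b) g i = 0.
  by rewrite big_nat_cond big1 // => i /andP[hi' _]; apply: g0; lia.
rewrite (big_cat_nat (n := lo)) /=; [|lia|lia].
by rewrite z1 (big_cat_nat (n := hi.+1)) /= ?z2 ?addn0 //; lia.
Qed.

(** * Spaced marks on a cycle split into two arcs *)

Section SpacedMarks.
Variables (g : nat -> nat) (A al be aj t K : nat).
Hypothesis Et : t = al + be + 2.
Hypothesis sh : al.+2 <= K.
Hypothesis haj : 0 < aj <= al.
Hypothesis gDt : forall m, g (m + t) = g m.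
Hypothesis gj : g (A + aj) = 2.
Hypothesis spaced : forall m m', m < m' < m + t -> 0 < g m -> 0 < g m' ->
  (g m <= m' - m) && (g m' <= m' - m).
Hypothesis cross_up : forall p r, A < p <= A + al -> A + al.+2 <= r < A + t ->
  0 < g p -> 0 < g r -> (p - A) + g r + (r - (A + al.+1)) + 1 <= K.
Hypothesis cross_down : forall p r, A < p <= A + al -> A + al.+2 <= r < A + t ->
  0 < g p -> 0 < g r -> (A + t - r) + g r + (A + al.+1 - p) + 1 <= K.

Let sum_before p : p <= A + aj -> A + aj < p + t -> \sum_(p <= m < A + aj) g m <= A + aj - p.
Proof.
move=> le1 le2; apply: sum_spaced_left => m m' h1 h2 h3 gm gm'.
have gm'' : 0 < g m' by case/orP: gm' => // /eqP ->; rewrite gj.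
by have /andP[] : (g m <= m' - m) && (g m' <= m' - m) by apply: spaced => //; lia.
Qed.

Let sum_after p : A + aj <= p -> p < A + aj + t -> \sum_((A + aj).+1 <= m < p.+1) g m <= p - (A + aj).
Proof.
move=> le1 le2; apply: sum_spaced_right => m m' h1 h2 h3 gm' gm.
have gm'' : 0 < g m by case/orP: gm => // /eqP ->; rewrite gj.
by have /andP[] : (g m <= m' - m) && (g m' <= m' - m) by apply: spaced => //; lia.
Qed.

(** Let [p1], [p2] and [r1], [r2] be the extreme marked positions inside the two arcs. The marks
    inside fill [p2 - p1 + 2] and at most [r2 - r1 + g r2], those at [A] and [A + al.+1] fit into
    the gaps before [p1] and [r1], and [cross_up] for [p2] and [r2] bounds the sum. *)
Lemma sum_marks_arc : \sum_(A <= m < A + t) g m <= K.+1.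
Proof.
(* With the second arc unmarked, spacing around [A + aj] gives at most [al + 3], and [sh]
   applies. *)
have [b0|b0] := posnP (\sum_(A + al.+2 <= m < A + t) g m).
  rewrite (big_cat_nat (n := A + al.+2)) /=; [|lia|lia].
  rewrite b0 addn0 (big_cat_nat (n := A + aj)) /=; [|lia|lia].
  rewrite [X in _ + X]big_ltn ?gj; last by lia.
  have := @sum_before A; have := @sum_after (A + al.+1); rewrite -addnS.
  move=> s1 s2; have {}s1 := s1 ltac:(lia) ltac:(lia); have {}s2 := s2 ltac:(lia) ltac:(lia).
  by lia.
have [r1 [r2 [hr1 hr2 gr1 gr2 rP]]] := support_span b0.
have a0 : 0 < \sum_(A.+1 <= m < A + al.+1) g m.
  rewrite (big_cat_nat (n := A + aj)) /=; [|lia|lia].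
  by rewrite [X in _ + X]big_ltn ?gj; lia.
have [p1 [p2 [hp1 hp2 gp1 gp2 pP]]] := support_span a0.
have pj : p1 <= A + aj <= p2 by apply: pP; rewrite ?gj //; lia.
have up := @cross_up p2 r2 ltac:(lia) ltac:(lia) gp2 gr2.
have down := @cross_down p1 r1 ltac:(lia) ltac:(lia) gp1 gr1.
have S1 : \sum_(A.+1 <= m < A + al.+1) g m <= (p2 - p1) + 2.
  rewrite (sum_support (lo := p1) (hi := p2)) //; try lia.
  rewrite (big_cat_nat (n := A + aj)) /=; [|lia|lia].
  rewrite [X in _ + X]big_ltn ?gj; last by lia.
  have s1 := @sum_before p1 ltac:(lia) ltac:(lia).
  have s2 := @sum_after p2 ltac:(lia) ltac:(lia).
  by lia.
have S2 : \sum_(A + al.+2 <= m < A + t) g m <= (r2 - r1) + minn (g r1) (g r2).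
  rewrite (sum_support (lo := r1) (hi := r2)) //; try lia.
  have s1 : \sum_(r1 <= m < r2) g m <= r2 - r1.
    apply: sum_spaced_left => m m' h1 h2 h3 gm gm'.
    have gm'' : 0 < g m' by case/orP: gm' => // /eqP ->.
    by have /andP[] : (g m <= m' - m) && (g m' <= m' - m) by apply: spaced => //; lia.
  have s2 : \sum_(r1.+1 <= m < r2.+1) g m <= r2 - r1.
    apply: sum_spaced_right => m m' h1 h2 h3 gm' gm.
    have gm'' : 0 < g m by case/orP: gm => // /eqP ->.
    by have /andP[] : (g m <= m' - m) && (g m' <= m' - m) by apply: spaced => //; lia.
  have e1 : \sum_(r1 <= m < r2.+1) g m = g r1 + \sum_(r1.+1 <= m < r2.+1) g m.
    by rewrite big_ltn //; lia.
  have e2 : \sum_(r1 <= m < r2.+1) g m = \sum_(r1 <= m < r2) g m + g r2.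
    by rewrite big_nat_recr //; lia.
  by lia.
have gA : g A <= p1 - A /\ g A <= A + t - r2.
  have [->|gA0] := posnP (g A); first by [].
  split.
    by have /andP[] : (g A <= p1 - A) && (g p1 <= p1 - A) by apply: spaced => //; lia.
  have gAt : 0 < g (A + t) by rewrite gDt.
  have /andP[_] : (g r2 <= A + t - r2) && (g (A + t) <= A + t - r2) by apply: spaced => //; lia.
  by rewrite gDt.
have gB : g (A + al.+1) <= A + al.+1 - p2 /\ g (A + al.+1) <= r1 - (A + al.+1).
  have [->|gB0] := posnP (g (A + al.+1)); first by [].
  split.
    have /andP[] : (g p2 <= A + al.+1 - p2) && (g (A + al.+1) <= A + al.+1 - p2).
      by apply: spaced => //; lia.
    by [].
  have /andP[] : (g (A + al.+1) <= r1 - (A + al.+1)) && (g r1 <= r1 - (A + al.+1)).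
    by apply: spaced => //; lia.
  by [].
rewrite big_ltn; last by lia.
rewrite (big_cat_nat (n := A + al.+1)) /=; [|lia|lia].
rewrite [X in _ + (_ + X)]big_ltn; last by lia.
rewrite -(addnS A); move: S1 S2 gA gB up down.
move: (\sum_(A.+1 <= m < A + al.+1) g m) (\sum_(A + al.+2 <= m < A + t) g m) => X1 X2.
move: (g A) (g (A + al.+1)) (g r1) (g r2) => gA gB g1 g2.
by lia.
Qed.

End SpacedMarks.

(** * Costs along an arc whose ends are joined by short paths only *)

Section ShortArcs.
Variables (G : sgraph) (x0 : G) (C H : seq G).
Hypothesis cH : is_cycle H.
Hypothesis HC : {in H, forall v, v \notin C}.
Hypothesis Hmax : forall D, is_cycle D -> {in D, forall v, v \notin C} -> size D <= size H.
Local Notation t := (size H).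
Local Notation u := (cnth x0 H).
Variable E : 'I_t -> seq G.
Hypothesis eE : extension x0 C E.
Local Notation omod := (omod cH).
Local Notation mk := (mark x0 E).
(** [avoid] will hold the vertices of the links at the two ends; a path that leaves them free can be
    prolonged by both links. *)
Variables (avoid : pred G) (A al be K : nat).
Hypothesis Et : t = al + be + 2.
Hypothesis tK : K.+2 <= t.
Hypothesis avoidH : {in H, forall v, ~~ avoid v}.
Hypothesis avoidE : forall l, l != omod A -> l != omod (A + al.+1) ->
  {in E l, forall v, ~~ avoid v}.
Hypothesis short : forall p, path_between (u A) (u (A + al.+1)) p -> uniq p ->
  {in p, forall v, (v \notin C) && ~~ avoid v} -> size p <= K.

Let t1 : 1 < t. Proof. by rewrite Et addn2. Qed.

Let uHP n : (u n \notin C) && ~~ avoid (u n).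
Proof. by rewrite HC ?avoidH ?cnth_in. Qed.

Lemma omod_neq m n : m < n < m + t -> omod m != omod n.
Proof.
move=> hmn; apply/eqP => /(congr1 val) /= Emn.
have := @cnth_inj_window _ x0 H cH m m n; rewrite /cnth Emn => Hi.
by have Ee : m = n; [apply: Hi => //; lia | lia].
Qed.

Lemma short_positions B ps : path_between (u A) (u (A + al.+1)) [seq u m | m <- ps] ->
  uniq ps -> (forall m, m \in ps -> B <= m < B + t) -> size ps <= K.
Proof.
move=> pp ups hB; rewrite -(size_map u); apply: (short pp); first exact: uniq_map_cnth ups hB.
by move=> v /mapP[m _ ->]; apply: uHP.
Qed.

(** The arc itself is one of the short paths. *)
Lemma arc_short : al.+2 <= K.
Proof.
have := @short_positions A (iota A ((A + al.+1).+1 - A)) (path_between_cnth x0 cH t1 (leq_addr _ _))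
  (iota_uniq _ _).
rewrite size_iota => Hs; apply: leq_trans (Hs _); first by lia.
by move=> m; rewrite mem_iota; lia.
Qed.

(** The path follows the arc to [A + a], jumps to [m'], runs back to [m] on the other arc, jumps to
    [A + a'] and goes on to the end. *)
Lemma row_short a a' m m' : a < a' <= al -> A + al.+2 <= m <= m' -> m' < A + t ->
  adj (u (A + a)) (u m') -> adj (u m) (u (A + a')) ->
  a + (m' - m) + (al - a') + 4 <= K.
Proof.
move=> ha hm hm' am' ma'.
have p1 := path_between_cnth x0 cH t1 (leq_addr a A).
have hmm : m <= m' by lia.
have p2 := path_between_cnth_rev x0 cH t1 hmm.
have ha' : A + a' <= A + al.+1 by lia.
have p3 := path_between_cnth x0 cH t1 ha'.
have := path_between_cat (path_between_cat p1 am' p2) ma' p3.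
rewrite -!map_cat => pp.
apply: leq_trans (@short_positions A _ pp _ _).
- by rewrite !size_cat size_rev !size_iota; lia.
- rewrite cat_uniq; apply/and3P; split; rewrite ?iota_uniq //.
    rewrite cat_uniq rev_uniq !iota_uniq andbT /=.
    by apply/hasPn => n; rewrite /= mem_rev !mem_iota; lia.
  by apply/hasPn => n; rewrite /= mem_cat mem_rev !mem_iota; lia.
by move=> n; rewrite !mem_cat mem_rev !mem_iota; lia.
Qed.

Definition row a := \sum_(A + al.+2 <= m < A + t) adj (u (A + a)) (u m).

(* Going through the rows in order, each new row is confined by the chord kept
   from the last nonempty one: otherwise the path that leaves the arc along the
   old chord and returns along the new one is too long. *)
Lemma sum_rows (R : pred nat) :
  \sum_(1 <= a < al.+1) R a * row a <=
  (\sum_(1 <= a < al.+1) R a) * (K - al.+2) + al.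
Proof.
have sh := arc_short.
have be0 : 0 < be by lia.
(* The pair [a], [m] is the kept chord, and [A + t - m] measures the room from its end to the end of
   the other arc. *)
suff Hind n : n <= al -> exists a m, [/\ a <= n, A + al.+2 <= m < A + t,
    adj (u (A + a)) (u m) &
    \sum_(1 <= i < n.+1) R i * row i + (A + t - m) <=
    (\sum_(1 <= i < n.+1) R i) * (K - al.+2) + a.+1].
  by have [a [m [an hm _ le]]] := Hind al (leqnn _); lia.
elim: n => [_|n IHn ltn].
  (* The first kept chord is the edge of [H] from [u A] to the last vertex of the other arc. *)
  exists 0, (A + t).-1; split; [by []|lia| |].
    rewrite addn0 -(cnth_addt x0 H A) adj_sym; have := adj_cnthS x0 cH (A + t).-1 t1.
    by rewrite prednK //; lia.
  by rewrite !big_geq //; lia.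
have [a [m [an hm am le]]] := IHn (ltnW ltn).
rewrite !(big_nat_recr n.+1) //=; case Rn: (R n.+1); last first.
  by exists a, m; split=> //; [lia | rewrite mul0n !addn0].
have [r0|r0] := posnP (row n.+1).
  exists a, m; split=> //; first by lia.
  by rewrite r0 muln0 addn0 mulnDl addnAC (leq_trans le) ?leq_addr.
have [lo [hi [h1 h2 alo ahi hP]]] := support_span r0.
exists n.+1, hi; split=> //; first by lia.
  by case: (adj _ _) ahi.
have rle : row n.+1 <= hi - lo + 1.
  rewrite /row (sum_support (lo := lo) (hi := hi)) //; try lia.
  apply: leq_trans (_ : \sum_(lo <= i < hi.+1) 1 <= _).
    by apply: leq_sum => i _; apply: leq_b1.
  by rewrite sum_nat_const_nat; lia.
(* If the new row starts no later than [m], [row_short] bounds [m - lo]; otherwise the row fits into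
   the room beyond [m]. *)
have [mlo|mlo] := leqP lo m.
  have := @row_short a n.+1 lo m; rewrite am.
  have -> : adj (u lo) (u (A + n.+1)) by rewrite adj_sym; case: (adj _ _) alo.
  move=> Hr; have : a + (m - lo) + (al - n.+1) + 4 <= K by apply: Hr => //; lia.
  move: le rle; rewrite mulnDl !mul1n.
  move: (row n.+1) (\sum_(1 <= i < n.+1) R i * row i) => r s.
  by move: (_ * (K - al.+2)) => q; lia.
move: le rle; rewrite mulnDl !mul1n.
move: (row n.+1) (\sum_(1 <= i < n.+1) R i * row i) => r s.
by move: (_ * (K - al.+2)) => q; lia.
Qed.

Lemma cyc_degree_row a : 0 < a <= al ->
  cyc_degree x0 (omod (A + a)) <= al.+1 + row a.
Proof.
move=> ha; have -> : cyc_degree x0 (omod (A + a)) =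
    \sum_(A <= m < A + t) adj (u (A + a)) (u m).
  rewrite (@big_nat_ord_mod (fun m => adj (u (A + a)) (u m) : nat)) //; last first.
  - by move=> m; rewrite cnth_addt.
  - by lia.
  rewrite /cyc_degree -sum1_card big_mkcond /=; apply: eq_bigr => l _.
  by rewrite inE cnth_omod; case: (@adj G _ _).
rewrite (big_cat_nat (n := A + al.+2)) /=; [|lia|lia].
rewrite -/(row a) leq_add2r (big_cat_nat (n := A + a)) /=; [|lia|lia].
rewrite [X in _ + X]big_ltn; last by lia.
rewrite adj_irr add0n.
apply: leq_trans (leq_add (_ : _ <= \sum_(A <= m < A + a) 1)
  (_ : _ <= \sum_((A + a).+1 <= m < A + al.+2) 1)) _.
- by apply: leq_sum => m _; apply: leq_b1.
- by apply: leq_sum => m _; apply: leq_b1.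
by rewrite !sum_nat_const_nat; lia.
Qed.

Lemma omod_inner m : A < m < A + t -> m != A + al.+1 ->
  omod m != omod A /\ omod m != omod (A + al.+1).
Proof.
move=> hm nm; have [h1 h2] : A < m < A + t /\ (m < A + al.+1 < m + t \/ A + al.+1 < m < A + al.+1 + t).
  by clear - hm nm Et; lia.
split; first by rewrite eq_sym; apply: omod_neq.
by case: h2 => h2; [|rewrite eq_sym]; apply: omod_neq.
Qed.

Section NontrivialInArc.
Variable aj : nat.
Hypothesis haj : 0 < aj <= al.
Let j := omod (A + aj).
Hypothesis nj : ~~ triv E j.
Let g m := mk j (omod m).

Let gDt m : g (m + t) = g m. Proof. by rewrite /g omodDt. Qed.

Let gj : g (A + aj) = 2. Proof. by rewrite /g /mark eqxx. Qed.

Let spaced m m' : m < m' < m + t -> 0 < g m -> 0 < g m' ->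
  (g m <= m' - m) && (g m' <= m' - m).
Proof.
move=> hm gm gm'; have Em : m' = m + (m' - m) by clear - hm; lia.
have hd : 0 < m' - m <= t by clear - hm; lia.
have neq := omod_neq hm.
rewrite /g Em in neq gm'.
by have := mark_spacing HC Hmax eE nj hd neq gm gm'; rewrite geq_max -Em.
Qed.

Let mark_total : outer_hits x0 E j + head_nbrs x0 E j + 2 = \sum_(A <= m < A + t) g m.
Proof.
rewrite (big_nat_ord_mod _ _ gDt); last by lia.
rewrite -sum_mark // [RHS](bigD1 j) //= [LHS]addnC; congr (_ + _).
  by rewrite -[LHS]gj; congr mk; apply: val_inj; rewrite /= modn_mod.
by apply: eq_bigr => i _; rewrite /g omod_ord.
Qed.

(** Only the paths at [j], [p] and [r] are used; none starts at an end of the arc, so the avoided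
    vertices stay free. *)
Let detour p r : A < p <= A + al -> A + al.+2 <= r < A + t -> 0 < g p -> 0 < g r ->
  exists h k s, [/\ adj (u p) h, path_between h k s, adj k (u r) & uniq s] /\
    [/\ {in s, forall v, v \notin H}, {in s, forall v, (v \notin C) && ~~ avoid v} &
        maxn (g p) (g r) <= (size s).+1].
Proof.
have [pE uE oE dE] := eE; move=> hp hr gp gr.
have neq : omod p != omod r by apply: omod_neq; clear - hp hr Et; lia.
have [j1 j2] : j != omod A /\ j != omod (A + al.+1).
  by apply: omod_inner; clear - haj Et; lia.
have [p1 p2] : omod p != omod A /\ omod p != omod (A + al.+1).
  by apply: omod_inner; clear - hp Et; lia.
have [r1 r2] : omod r != omod A /\ omod r != omod (A + al.+1).
  by apply: omod_inner; clear - hr; lia.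
have [s [s0 ps us sE le]] := connection eE nj neq gp gr.
have [h [k [ph pb kr]]] := walk_path_between s0 ps; rewrite !cnth_omod in ph kr.
exists h, k, s; split=> //; split=> // v /sE.
  by case/or3P => /oE /andP[].
by case/or3P => vE; have /andP[_ ->] := oE _ _ vE; apply: (avoidE _ _ vE).
Qed.

Let glue ps ps' s : uniq (ps ++ ps') -> (exists B, forall m, m \in ps ++ ps' -> B <= m < B + t) ->
  uniq s -> {in s, forall v, v \notin H} -> uniq ([seq u m | m <- ps] ++ s ++ [seq u m | m <- ps']).
Proof.
move=> ups [B hB] us sH; have := uniq_map_cnth x0 cH ups hB.
rewrite map_cat !cat_uniq has_cat negb_or us => /and3P[-> d1 ->]; rewrite andbT d1 andbT /=.
apply/andP; split; apply/hasPn => v.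
  by move=> /sH nv; apply/negP => /mapP[m _ Ev]; rewrite Ev cnth_in in nv.
by move=> /mapP[m _ ->]; apply/negP => /sH; rewrite cnth_in.
Qed.

Let glueP ps ps' s : {in s, forall v, (v \notin C) && ~~ avoid v} ->
  {in [seq u m | m <- ps] ++ s ++ [seq u m | m <- ps'], forall v, (v \notin C) && ~~ avoid v}.
Proof.
by move=> sP v; rewrite !mem_cat => /or3P[/mapP[m _ ->]|/sP|/mapP[m _ ->]] //; apply: uHP.
Qed.

(** The short path runs from [A] up to [p], over the detour to [r], and back down to [A + al.+1]. *)
Let cross_up p r : A < p <= A + al -> A + al.+2 <= r < A + t -> 0 < g p -> 0 < g r ->
  (p - A) + g r + (r - (A + al.+1)) + 1 <= K.
Proof.
move=> hp hr gp gr.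
have [h [k [s [[ph pb kr us] [sH sP le]]]]] := detour hp hr gp gr.
have lp : A <= p by clear - hp; lia.
have lr : A + al.+1 <= r by clear - hr; lia.
have := path_between_cat (path_between_cnth x0 cH t1 lp) ph
  (path_between_cat pb kr (path_between_cnth_rev x0 cH t1 lr)).
move/short => Hs; have {Hs} : size ([seq u i | i <- iota A (p.+1 - A)] ++
    s ++ [seq u i | i <- rev (iota (A + al.+1) (r.+1 - (A + al.+1)))]) <= K.
  apply: Hs; last exact: glueP.
  apply: glue => //.
    rewrite cat_uniq rev_uniq !iota_uniq andbT /=.
    by apply/hasPn => n; rewrite /= mem_rev !mem_iota; clear - hp hr Et; lia.
  by exists A => m; rewrite mem_cat mem_rev !mem_iota; clear - hp hr Et; lia.
rewrite !size_cat !size_map size_rev !size_iota.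
move: le; rewrite geq_max => /andP[_]; move: (size s) (g p) (g r) => n a b; clear - hp hr; lia.
Qed.

(** The same in the other direction: from [A + t] down to [r], over the detour to [p], up to
    [A + al.+1]. *)
Let cross_down p r : A < p <= A + al -> A + al.+2 <= r < A + t -> 0 < g p -> 0 < g r ->
  (A + t - r) + g r + (A + al.+1 - p) + 1 <= K.
Proof.
move=> hp hr gp gr.
have [h [k [s [[ph pb kr us] [sH sP le]]]]] := detour hp hr gp gr.
have lp : p <= A + al.+1 by clear - hp; lia.
have lr : r <= A + t by clear - hr; lia.
have p1 := path_between_cnth_rev x0 cH t1 lr; rewrite cnth_addt in p1.
have p3 := path_between_cnth x0 cH t1 lp.
have rk : adj (u r) k by rewrite adj_sym.
have hp' : adj h (u p) by rewrite adj_sym.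
have := path_between_cat p1 rk (path_between_cat (path_between_rev pb) hp' p3).
move/short => Hs; have {Hs} : size ([seq u i | i <- rev (iota r ((A + t).+1 - r))] ++
    rev s ++ [seq u i | i <- iota p ((A + al.+1).+1 - p)]) <= K.
  apply: Hs; last by apply: glueP => v; rewrite mem_rev; apply: sP.
  apply: glue.
  - rewrite cat_uniq rev_uniq !iota_uniq andbT /=.
    by apply/hasPn => n; rewrite /= mem_rev !mem_iota; clear - hp hr Et; lia.
  - by exists A.+1 => m; rewrite mem_cat mem_rev !mem_iota; clear - hp hr Et; lia.
  - by rewrite rev_uniq.
  by move=> v; rewrite mem_rev; apply: sH.
rewrite !size_cat !size_map !size_rev !size_iota.
move: le; rewrite geq_max => /andP[_]; move: (size s) (g p) (g r) => n a b; clear - hp hr; lia.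
Qed.

Lemma cost_nontriv_arc : outer_hits x0 E j + head_nbrs x0 E j + 1 <= K.
Proof.
have := sum_marks_arc Et arc_short haj gDt gj spaced cross_up cross_down.
by rewrite -mark_total addn2 addn1.
Qed.

End NontrivialInArc.

(** A nontrivial index costs at most [K.-1], a trivial one at most [al.+1] plus its row. By
    [sum_rows] the [r] trivial ones cost at most [r * K.-1 + al] together, and the surplus [al]
    raises the average to [K]. *)
Lemma sum_cost_arc : \sum_(1 <= a < al.+1) cost x0 E (omod (A + a)) <= al * K.
Proof.
have sh := arc_short.
pose R a := triv E (omod (A + a)).
have le1 a : 1 <= a < al.+1 -> cost x0 E (omod (A + a)) <=
    R a * row a + (R a * al.+1 + (~~ R a) * K.-1).
  move=> ha; rewrite /cost /R; case: (boolP (triv _ _)) => ta.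
    by rewrite !mul1n mul0n addn0 [leqRHS]addnC; apply: cyc_degree_row; lia.
  rewrite !mul0n mul1n !add0n.
  by have := @cost_nontriv_arc a ltac:(lia) ta; lia.
apply: leq_trans (_ : \sum_(1 <= a < al.+1)
  (R a * row a + (R a * al.+1 + (~~ R a) * K.-1)) <= _).
  rewrite big_nat_cond [leqRHS]big_nat_cond; apply: leq_sum => a; rewrite andbT; exact: le1.
rewrite !big_split /=; have := sum_rows R.
rewrite -!big_distrl /=.
have : \sum_(1 <= a < al.+1) R a + \sum_(1 <= a < al.+1) ~~ R a = al.
  rewrite -big_split /= (eq_bigr (fun=> 1)) => [|a _]; last by case: (R a).
  by rewrite sum_nat_const_nat subn1 muln1.
move: (\sum_(1 <= a < al.+1) R a) (\sum_(1 <= a < al.+1) ~~ R a) => r r' Er.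
move: (\sum_(1 <= a < al.+1) R a * row a) => s le.
have [n En] : exists n, K = al.+2 + n by exists (K - al.+2); lia.
rewrite En addKn in le; have -> : K.-1 = al.+1 + n by lia.
rewrite En; apply: leq_trans (leq_add le (leqnn _)) _.
rewrite -[X in _ <= X * _]Er; nia.
Qed.

End ShortArcs.

(** Both ends are left out of [s], so that [s] can serve directly as a path of an extension. *)
Definition link (G : sgraph) (C H : seq G) (z x : G) (s : seq G) : Prop :=
  [/\ x \in H, path (@adj G) x s, adj (last x s) z, uniq s &
      {in s, forall v, (v \notin H) && (v \notin C)}].

(** * The order of the graph when two linked vertices are joined by short paths only *)

Section SecondBound.
Variables (G : sgraph) (C H : seq G) (d K : nat) (z z' : G).
Hypothesis lC : longest_cycle C.
Hypothesis cH : is_cycle H.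
Hypothesis HC : {in H, forall v, v \notin C}.
Hypothesis Hmax : forall D, is_cycle D -> {in D, forall v, v \notin C} -> size D <= size H.
Hypothesis degd : forall v : G, d <= degree v.
Hypothesis tK : K.+2 <= size H.
Hypothesis short : forall h k p, adj z h -> path_between h k p -> adj k z' -> uniq p ->
  {in p, forall v, v \notin C} -> size p <= K.
Local Notation t := (size H).
Local Notation link := (link C H).

Let linked2 (q : (G * seq G) * (G * seq G)) : Prop :=
  [/\ link z q.1.1 q.1.2, link z' q.2.1 q.2.2, q.1.1 != q.2.1 &
      {in q.1.2, forall v, v \notin q.2.2}].

Let link_suffix z1 x x' p w q : link z1 x (p ++ w :: q) -> x' \in H -> adj x' w ->
  link z1 x' (w :: q).
Proof.
move=> [xH pq lz us oq] x'H x'w; split=> //.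
- by move: pq; rewrite cat_path /= x'w => /and3P[].
- by move: lz; rewrite last_cat.
- by move: us; rewrite cat_uniq => /and3P[].
by move=> v vq; apply: oq; rewrite mem_cat vq orbT.
Qed.

(** Two disjoint links of least total size form the initial system. Their ends cut [H] into two arcs
    on which the costs average at most [K], and the two ends cost at most [t - 1] each. *)
Lemma order_lower_bound_short : (exists q, linked2 q) ->
  t * d + t + 1 <= #|G| + (t - 2) * K + 2 * (t - 1).
Proof.
move=> exq; have [[[x s1] [y s2]] [] /= L1 L2 xy dis qmin] :=
  exists_min (fun q : (G * seq G) * (G * seq G) => size q.1.2 + size q.2.2) exq.
have x0 := x; pose u := cnth x0 H.
have [xH p1 l1 us1 o1] := L1; have [yH p2 l2 us2 o2] := L2.
have uC : uniq C by case: lC => /and3P[].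
have [nx ltx Ex] := cnth_surj x0 xH; have [ny lty Ey] := cnth_surj x0 yH.
pose X := Ordinal ltx; pose Y := Ordinal lty.
have XY : X != Y by apply: contraNneq xy => EXY; rewrite Ex Ey; have -> : nx = ny by case: EXY.
have uX : u X = x by rewrite Ex.
have uY : u Y = y by rewrite Ey.
pose act : pred 'I_t := [pred i | (i == X) || (i == Y)].
pose E0 (i : 'I_t) := if i == X then s1 else if i == Y then s2 else [::].
have EX : E0 X = s1 by rewrite /E0 eqxx.
have EY : E0 Y = s2 by rewrite /E0 eq_sym (negbTE XY) eqxx.
have inE0 i v : v \in E0 i -> (i = X /\ v \in s1) \/ (i = Y /\ v \in s2).
  rewrite /E0; case: eqP => [->|_]; first by left.
  by case: eqP => [->|_]; first by right.
have eE0 : extension x0 C E0.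
  split; rewrite /E0.
  - move=> i; case: eqP => [->|_]; first by rewrite /= -Ex.
    by case: eqP => [->|_]; first by rewrite /= -Ey.
  - by move=> i; case: eqP => // _; case: eqP.
  - by move=> i v /inE0[[_ /o1]|[_ /o2]].
  move=> i j v /inE0[[-> v1]|[-> v2]] /inE0[[-> w1]|[-> w2]] //.
    by have := dis v v1; rewrite /= w2.
  by have := dis v w1; rewrite /= v2.
have aE0 i : ~~ act i -> E0 i = [::].
  by rewrite /act /E0 /= negb_or => /andP[/negbTE-> /negbTE->].
(* A neighbour [w] of [u i] that is not first on a link would start a shorter link from [u i],
   against minimality. *)
have mE0 (i l : 'I_t) w : ~~ act i -> adj (u i) w -> w \in E0 l -> ohead (E0 l) = Some w.
  rewrite /act /= negb_or => /andP[iX iY] iw.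
  have uiH : u i \in H by apply: cnth_in.
  have nui (j : 'I_t) : i != j -> u i != u j.
    by apply: contra => /eqP /(cnth_ord_inj cH)/eqP.
  rewrite /E0; case: eqP => [_|_]; last case: eqP => // _.
    move=> ws; case/splitPr Es : {1}s1 / ws => [[|a p] q] //.
    have := qmin ((u i, w :: q), (y, s2)); rewrite /= Es size_cat /= => Hq.
    have : (size p).+1 + (size q).+1 + size s2 <= (size q).+1 + size s2; last by clear; lia.
    apply: Hq; split=> //=.
    - by apply: link_suffix uiH iw; rewrite Es in L1; exact: L1.
    - by rewrite Ey; apply: (nui Y).
    by move=> v vq; apply: dis; rewrite Es mem_cat vq orbT.
  move=> ws; case/splitPr Es : {1}s2 / ws => [[|a p] q] //.
  have := qmin ((x, s1), (u i, w :: q)); rewrite /= Es size_cat /= => Hq.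
  have : size s1 + ((size p).+1 + (size q).+1) <= size s1 + (size q).+1; last by clear; lia.
  apply: Hq; split=> //=.
  - by apply: link_suffix uiH iw; rewrite Es in L2; exact: L2.
  - by rewrite Ex eq_sym; apply: (nui X).
  move=> v vs; have := dis v vs; rewrite /= Es mem_cat negb_or => /andP[].
  by [].
have [E [eE rE tipN trivN]] := exists_saturated_extension cH HC eE0 aE0 mE0 uC.
pose avoid v := (v \in s1) || (v \in s2).
have avoidH : {in H, forall v, ~~ avoid v}.
  move=> v vH; rewrite /avoid negb_or; apply/andP; split; apply/negP.
    by move/o1; rewrite vH.
  by move/o2; rewrite vH.
have avoidE l : l != X -> l != Y -> {in E l, forall v, ~~ avoid v}.
  move=> lX lY v vl; have [_ k2 _ _] := rE.
  have /existsPn nv : ~~ [exists i, v \in E0 i].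
    by apply: (k2 l) => //; rewrite /act /= negb_or lX.
  by rewrite /avoid negb_or -{1}EX -EY !nv.
(* Prolonged by the two links, [p] joins a neighbour of [z] to one of [z'], so [short] applies. *)
have shortXY p : path_between (u X) (u Y) p -> uniq p ->
    {in p, forall v, (v \notin C) && ~~ avoid v} -> size p <= K.
  move=> pp up pP; rewrite uX uY in pp.
  apply: leq_trans (_ : size (rev s1 ++ p ++ s2) <= _).
    by rewrite !size_cat addnCA leq_addr.
  apply: short (path_between_ext p1 p2 pp) l2 _ _; first by rewrite adj_sym.
    rewrite !cat_uniq rev_uniq us1 up us2 has_cat !negb_or /= andbT.
    apply/andP; split; first (apply/andP; split).
    - apply/hasPn => v /pP /andP[_]; rewrite /avoid negb_or /= mem_rev => /andP[].
      by [].
    - by apply/hasPn => v v2; rewrite /= mem_rev; apply/negP => /dis; rewrite /= v2.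
    apply/hasPn => v v2; apply/negP => /pP /andP[_]; by rewrite /avoid v2 orbT.
  move=> v; rewrite !mem_cat mem_rev => /or3P[/o1/andP[]//|/pP/andP[]//|/o2/andP[]//].
have [D hD ED] := omod_dist cH XY.
have [al [be [Eal Et]]] : exists al be, D = al.+1 /\ t = al + be + 2.
  by exists D.-1, (t - D.+1); clear - hD; lia.
have e1 : al.+1 + be.+1 = t by clear - Et; lia.
have EA : omod cH X = X by apply: omod_ord.
have EB : omod cH (X + al.+1) = Y by rewrite -Eal.
have EA' : omod cH (X + al.+1 + be.+1) = X by rewrite -addnA e1 omodDt.
have uB : u (X + al.+1) = u Y by rewrite -EB [RHS]cnth_omod.
have uA' : u (X + al.+1 + be.+1) = u X by rewrite -[in RHS]EA' [RHS]cnth_omod.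
have arc1 : \sum_(1 <= a < al.+1) cost x0 E (omod cH (X + a)) <= al * K.
  apply: (@sum_cost_arc _ x0 C H cH HC Hmax E eE avoid X al be K Et tK avoidH).
    by move=> l; rewrite EA EB; apply: avoidE.
  by rewrite -/u uB.
have Et' : t = be + al + 2 by rewrite (addnC be).
(* The second arc starts at [Y] and returns to [X]; short paths are used in reverse. *)
have arc2 : \sum_(1 <= a < be.+1) cost x0 E (omod cH (X + al.+1 + a)) <= be * K.
  apply: (@sum_cost_arc _ x0 C H cH HC Hmax E eE avoid (X + al.+1) be al K Et' tK avoidH).
    by move=> l; rewrite EA' EB => lY lX; apply: avoidE.
  rewrite -/u uB uA' => p pp up pP; rewrite -size_rev; apply: shortXY.
  - exact: path_between_rev.
  - by rewrite rev_uniq.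
  by move=> v; rewrite mem_rev; apply: pP.
have sc : \sum_i cost x0 E i <= (t - 2) * K + 2 * (t - 1).
  have -> : \sum_i cost x0 E i = \sum_(X <= m < X + t) cost x0 E (omod cH m).
    rewrite (@big_nat_ord_mod (fun m => cost x0 E (omod cH m))).
    - by apply: eq_bigr => i _; rewrite omod_ord.
    - exact: cycle_size_gt0.
    by move=> m; rewrite omodDt.
  have c1 := cost_lt cH HC Hmax eE X; have c2 := cost_lt cH HC Hmax eE Y.
  have sh (f : nat -> nat) a n : \sum_(1 <= m < n.+1) f (a + m) = \sum_(a.+1 <= m < (a + n).+1) f m.
    elim: n => [|n IHn]; first by rewrite addn0 !big_geq.
    by rewrite big_nat_recr //= IHn addnS [RHS]big_nat_recr //= ltnS leq_addr.
  rewrite (sh (fun m => cost x0 E (omod cH m))) in arc1.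
  rewrite (sh (fun m => cost x0 E (omod cH m))) in arc2.
  have b1 : X < X + t by move: (nat_of_ord X) => m; clear - e1; lia.
  have b2 : X < X + al.+1 <= X + t by move: (nat_of_ord X) => m; clear - e1; lia.
  have b3 : X + al.+1 < X + t by move: (nat_of_ord X) => m; clear - e1; lia.
  rewrite big_ltn // (big_cat_nat (n := X + al.+1)) /=; try by case/andP: b2.
  rewrite [X in _ + (_ + X)]big_ltn //.
  have e2 : (X + al.+1 + be).+1 = X + t by move: (nat_of_ord X) => m; clear - e1; lia.
  rewrite -addnS in arc1; rewrite e2 in arc2.
  rewrite EB EA; move: arc1 arc2 c1 c2.
  move: (\sum_(_ <= m < _) _) (\sum_(_ <= m < _) _) (cost x0 E X) (cost x0 E Y).
  move=> b a c1 c2 arc1 arc2 h1 h2.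
  have -> : (t - 2) * K = al * K + be * K.
    by rewrite -mulnDl; congr (_ * _); clear - Et; lia.
  by clear - arc1 arc2 h1 h2; move: (al * K) (be * K) arc1 arc2 => ? ? ? ?; lia.
have sE := sum_size_extension cH HC uC eE.
have sd := sum_degrees cH eE tipN trivN degd.
have sa := sum_attached_lt lC cH HC eE.
move: sE sd sa sc; move: (\sum_i size (E i)) (\sum_i attached x0 C E i) (\sum_i cost x0 E i).
move=> e a c; move: (_ * d) (_ * K) (2 * _) (size C) => m1 m2 m3 m4.
by move: (size H) #|G| => m5 m6; clear; lia.
Qed.

End SecondBound.

From mathcomp Require Import all_order all_algebra.
Import Order.TTheory GRing.Theory Num.Theory.

(** * Proof of the theorem *)

Lemma min_degree_le (G : sgraph) (v : G) : min_degree G <= degree v.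
Proof.
rewrite /min_degree; have : v \in index_enum G by rewrite mem_index_enum.
elim: (index_enum G) => //= a r IHr; rewrite inE big_cons => /orP[/eqP<-|/IHr le].
  exact: geq_minl.
by apply: leq_trans le; apply: geq_minr.
Qed.

Lemma cycle_del (G : sgraph) (S : {set G}) (s : seq (del S)) :
  is_cycle [seq val x | x <- s] = is_cycle s.
Proof.
rewrite /is_cycle size_map map_inj_uniq; last exact: val_inj.
by rewrite cycle_map.
Qed.

Lemma cbar_cycle (G : sgraph) (C : seq G) : 0 < cbar C ->
  exists H, [/\ is_cycle H, {in H, forall v, v \notin C} & size H = cbar C].
Proof.
rewrite /cbar /circumference; set G' := del _.
pose P (k : 'I_(#|G'|.+1)) := [exists s : k.-tuple G', is_cycle s].
rewrite -/(\max_(k < #|G'|.+1 | P k) k).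
have [/existsP[k0 Pk0] _|] := boolP [exists k, P k]; last first.
  by rewrite negb_exists => /forallP nP; rewrite big_pred0 // => k; apply/negbTE.
rewrite (bigop.bigmax_eq_arg k0) //; case: arg_maxnP => // k /existsP[s cs] _.
exists [seq val x | x <- s]; split; first by rewrite cycle_del.
  by move=> _ /mapP[x _ ->]; have := valP x; rewrite inE.
by rewrite size_map size_tuple.
Qed.

Lemma size_cycle_le_cbar (G : sgraph) (C D : seq G) :
  is_cycle D -> {in D, forall v, v \notin C} -> size D <= cbar C.
Proof.
move=> cD DC; rewrite /cbar; set S := [set x in C].
have [s Es] : exists s : seq (del S), [seq val x | x <- s] = D.
  elim: D DC {cD} => [_|v D IHD DC]; first by exists [::].
  have [|s Es] := IHD; first by move=> w wD; apply: DC; rewrite inE wD orbT.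
  have vS : v \notin S by rewrite inE; apply: DC; rewrite mem_head.
  by exists (Sub v vS :: s); rewrite /= Es.
move: cD; rewrite -Es cycle_del size_map => cs.
have us : uniq s by case/and3P: cs.
have ltk : size s < #|del S|.+1 by rewrite ltnS -(card_uniqP us) max_card.
rewrite /circumference.
apply: (@bigop.leq_bigmax_cond _ (fun k : 'I_(#|del S|.+1) => [exists s : k.-tuple (del S), is_cycle s])
  (fun k => k) (Ordinal ltk)).
by apply/existsP; exists (in_tuple s).
Qed.

(** Deleting fewer than [k] vertices leaves some of [A] and of [B], still connected to each
    other. *)
Lemma k_connected_separates (G : sgraph) (A B S : {set G}) k :
  k_connected k G -> k <= #|A| -> k <= #|B| -> separates (@adj G) A B S -> k <= #|S|.
Proof.
move=> [_ kconn] kA kB sep; rewrite leqNgt; apply/negP => ltS.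
have pick (X : {set G}) : k <= #|X| -> exists2 x, x \in X & x \notin S.
  move=> kX; have /subsetPn[x xX xS] : ~~ (X \subset S).
    by apply: contraTN ltS => /subset_leq_card le; rewrite -leqNgt (leq_trans kX).
  by exists x.
have [a aA aS] := pick A kA; have [b bB bS] := pick B kB.
have [_ conn] := kconn S ltS.
pose a' : del S := Sub a aS; pose b' : del S := Sub b bS.
have /connectP[p pp lp] := conn a' b'.
have : set_path (@adj G) A B (val a' :: [seq val x | x <- p]).
  apply/and3P; split; [exact: aA | by rewrite path_map | by rewrite last_map -lp].
rewrite -map_cons => /sep/hasP[_ /mapP[x _ ->]] /=.
by rewrite (negbTE (valP x)).
Qed.

(** Stop at the first vertex on [C] and start at the last vertex of [H] before it. *)
Lemma set_path_link (G : sgraph) (C H p : seq G) :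
  {in H, forall v, v \notin C} ->
  set_path (@adj G) [set x in H] [set x in C] p -> uniq p ->
  exists x s z, [/\ link C H z x s, z \in C & {subset x :: rcons s z <= p}].
Proof.
move=> HC pp up.
have hC : has (mem [set x in C]) p.
  case: p pp {up} => // a q /and3P[_ _ l]; apply/hasP; exists (last a q) => //.
  exact: mem_last.
have [p1 [z [p2 [Ep zC n1]]]] := split_first hC; rewrite inE in zC.
have hH : has (mem [set x in H]) (rev p1).
  rewrite has_rev; case: p1 Ep n1 => [|a q] Ep _.
    by move: pp; rewrite Ep /= inE => /and3P[/HC]; rewrite zC.
  by move: pp; rewrite Ep /= => /andP[aH _]; rewrite aH.
have [q1 [x [q2 [Eq xH n2]]]] := split_first hH; rewrite inE in xH.
have {}Eq : p1 = rev q2 ++ x :: rev q1.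
  by rewrite -[p1]revK Eq rev_cat rev_cons cat_rcons.
have pw : path (@adj G) x (rev q1 ++ z :: p2).
  move: pp; rewrite Ep Eq -catA; case: (rev q2) => [|a q] /=; first by case/and3P.
  by rewrite cat_path /= => /and3P[_ /and3P[]].
have uw : uniq (x :: rev q1 ++ z :: p2).
  by move: up; rewrite Ep Eq -catA cat_uniq => /and3P[].
exists x, (rev q1), z; split=> //; last first.
  move=> v; rewrite Ep Eq -catA mem_cat inE mem_rcons inE mem_cat !inE.
  by case/or3P=> ->; rewrite ?orbT.
split=> //.
- by move: pw; rewrite cat_path => /andP[].
- by move: pw; rewrite cat_path /= => /and3P[].
- by move: uw => /= /andP[_]; rewrite cat_uniq => /andP[].
move=> v vq; apply/andP; split.
  apply/negP => vH; have /hasPn/(_ v) := n2; rewrite /= inE vH => nv.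
  by move: vq; rewrite mem_rev => /nv.
apply/negP => vC; have /hasPn/(_ v) := n1; rewrite /= inE vC => nv.
by suff /nv : v \in p1; rewrite // Eq mem_cat inE vq !orbT.
Qed.

(** * A long outside cycle linked to the longest cycle *)

Section LongCycleOutside.
Variables (G : sgraph) (C H : seq G) (k lam d : nat).
Hypothesis lC : longest_cycle C.
Hypothesis cH : is_cycle H.
Hypothesis HC : {in H, forall v, v \notin C}.
Hypothesis Hmax : forall D, is_cycle D -> {in D, forall v, v \notin C} -> size D <= size H.
Hypothesis degd : forall v : G, d <= degree v.
Hypothesis kG : k_connected k G.
Hypothesis lam_gt0 : 0 < lam.
Hypothesis ktH : k <= size H.
Hypothesis ltH : lam < size H.

(** Menger's theorem gives [k] disjoint links with ends [Z] on [C]. If all pairs in [Z] are far,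
    weight [lam.+1] on each is spaced on [C]; a pair that is not far meets the assumption of the
    second bound with [K = lam.-1]. *)
Lemma long_or_dense : k * lam.+1 <= size C \/
  size H * d + size H + 1 <= #|G| + (size H - 2) * lam.-1 + 2 * (size H - 1).
Proof.
have [cC maxC] := lC.
have uC : uniq C by case/and3P: cC.
have uH : uniq H by case/and3P: cH.
have sHC : size H <= size C by apply: maxC.
have cHs : #|[set x in H]| = size H by rewrite cardsE; apply/card_uniqP.
have cCs : #|[set x in C]| = size C by rewrite cardsE; apply/card_uniqP.
have [D [P [cD PD Pd]]] : linked (@adj G) [set x in H] [set x in C] k.
  apply: menger; first exact: adj_irr.
  by move=> S; apply: k_connected_separates; rewrite ?cHs ?cCs //; apply: leq_trans sHC.
have [f fP] : exists f : G -> G * seq G * G, forall s, s \in D ->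
    [/\ link C H (f s).2 (f s).1.1 (f s).1.2, (f s).2 \in C &
        {subset (f s).1.1 :: rcons (f s).1.2 (f s).2 <= P s}].
  apply: (@fin_all_exists _ _ (fun s q => s \in D ->
    [/\ link C H q.2 q.1.1 q.1.2, q.2 \in C & {subset q.1.1 :: rcons q.1.2 q.2 <= P s}])).
  move=> s; have [sD|nsD] := boolP (s \in D); last by exists ((s, [::]), s).
  have /andP[ps us] := PD s sD.
  by have [x [q [z [h1 h2 h3]]]] := set_path_link HC ps us; exists ((x, q), z).
pose zf s := (f s).2.
have zP s : s \in D -> zf s \in P s.
  by move=> sD; have [_ _] := fP s sD; apply; rewrite inE mem_rcons mem_head orbT.
have zinj : {in D &, injective zf}.
  by move=> s s' sD s'D Ez; apply: (Pd s s' (zf s)); rewrite ?sD ?s'D ?zP // Ez zP.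
pose Z := [set zf s | s in D].
have cZ : #|Z| = k by rewrite card_in_imset.
have ZC z : z \in Z -> z \in C by move=> /imsetP[s sD ->]; have [] := fP s sD.
pose far z z' := exists h kk s, [/\ adj z h, path_between h kk s, adj kk z', uniq s &
  {in s, forall v, v \notin C} /\ lam <= size s].
have [allfar|] := classic (forall z z', z \in Z -> z' \in Z -> z != z' -> far z z').
  left; rewrite -cZ -sum_nat_const.
  have [x0 _] : exists x, x \in H by case: (H) cH => // x s _; exists x; rewrite mem_head.
  have W1 z : 0 < (if z \in Z then lam.+1 else 0) -> z \in Z by case: ifP.
  have := @sum_gaps G x0 C lC (fun z => if z \in Z then lam.+1 else 0) _ _.
  rewrite big_mkcond /= (_ : \sum_(i : G) _ = \sum_(z in Z) lam.+1); last first.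
    rewrite [RHS]big_mkcond; apply: eq_bigr => z _.
    by case: (boolP (z \in Z)) => [/ZC->|_] //; case: ifP.
  apply.
    (* A full turn is long enough, as [lam < size H <= size C]. *)
    by move=> z _ /W1 zZ; rewrite zZ (leq_trans ltH).
  move=> z z' zC z'C zz' /W1 zZ /W1 z'Z.
  have [h [kk [s [e1 e2 e3 e4 [e5 e6]]]]] := allfar z z' zZ z'Z zz'.
  by exists h, kk, s; split=> //; split=> //; rewrite zZ ltnS.
move=> nfar; right.
have [z [z' [zZ z'Z zz' nf]]] : exists z z', [/\ z \in Z, z' \in Z, z != z' & ~ far z z'].
  apply: NNPP => nex; apply: nfar => z z' zZ z'Z zz'; apply: NNPP => nf.
  by apply: nex; exists z, z'.
apply: (@order_lower_bound_short G C H d lam.-1 z z') => //.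
- by rewrite prednK.
- move=> h kk p zh pp kz up pC; rewrite -ltnS prednK // ltnNge; apply/negP => le.
  by apply: nf; exists h, kk, p.
have [s sD Ez] := imsetP zZ; have [s' s'D Ez'] := imsetP z'Z.
have ss' : s != s' by apply: contraNneq zz' => Es; rewrite Ez Ez' Es.
have [L1 _ sub1] := fP s sD; have [L2 _ sub2] := fP s' s'D.
have dis v : v \in P s -> v \notin P s'.
  by move=> v1; apply/negP => v2; rewrite (Pd s s' v sD s'D v1 v2) eqxx in ss'.
exists ((f s).1, (f s').1); split=> /=.
- by rewrite Ez.
- by rewrite Ez'.
- apply: contraTneq (dis (f s).1.1 (sub1 _ (mem_head _ _))) => ->.
  by rewrite negbK; apply: sub2; rewrite mem_head.
move=> v v1; apply: contraNN (dis v _) => [v2|]; [apply: sub2|apply: sub1].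
  by rewrite inE mem_rcons inE v2 !orbT.
by rewrite inE mem_rcons inE v1 !orbT.
Qed.

End LongCycleOutside.

Theorem theorem4 (G : sgraph) (C : seq G) (lambda : nat) :
  longest_cycle C ->
  1 <= lambda <= min_degree G ->
  k_connected (min_degree G - lambda + 1) G ->
  ((#|G| + 2)%:R / (lambda + 1)%:R + lambda%:R - 2%:R <= (min_degree G)%:R :> rat)%R ->
  cbar C <= minn (lambda - 1) (min_degree G - lambda).
Proof.
move=> lC hlam kG hn; set d := min_degree G in hlam kG hn *.
have {}hn : #|G| + 2 <= (lambda + 1) * (d - lambda + 2).
  have l0 : (0 < (lambda + 1)%:R :> rat)%R by rewrite ltr0n addn1.
  move: hn; rewrite lerBlDr -lerBrDr ler_pdivrMr // -natrD -natrB; last by lia.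
  by rewrite -natrM ler_nat; nia.
rewrite leqNgt; apply/negP => ltc.
have t0 : 0 < cbar C by lia.
have [H [cH HC EH]] := cbar_cycle t0.
have Hmax D : is_cycle D -> {in D, forall v, v \notin C} -> size D <= size H.
  by rewrite EH; apply: size_cycle_le_cbar.
have degd (v : G) : d <= degree v := min_degree_le v.
rewrite -EH in ltc.
have [le|gt] := leqP (size H) (maxn lambda (d - lambda + 1)).
  have td : size H <= d by lia.
  have := order_lower_bound lC cH HC Hmax degd td.
  move: (size H) #|G| ltc le td hn => t n; clear -hlam => ltc le td hn.
  have [m Em] : exists m, d = lambda + m by exists (d - lambda); lia.
  have E2 : d - lambda = m by lia.
  (* The factors [t.+1] and [d - t + 2] have constant sum [d + 3], so for [t] between [lambda] and
     [m.+1] their product is at least its value at the ends, [lambda.+1 * m.+2], against [hn]. *)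
  rewrite E2 in ltc le hn; have [h|h] : lambda <= t <= m.+1 \/ m.+1 <= t <= lambda by lia.
    have [x [y [Ex Ey]]] : exists x y, t = lambda + x /\ m.+1 = t + y.
      by exists (t - lambda), (m.+1 - t); lia.
    have -> : d - t + 2 = lambda + y + 1 by lia.
    have Em2 : m + 2 = lambda + x + y + 1 by lia.
    by rewrite Ex Em2 in hn *; nia.
  have [x [y [Ex Ey]]] : exists x y, t = m.+1 + x /\ lambda = t + y.
    by exists (t - m.+1), (lambda - t); lia.
  have -> : d - t + 2 = m + y + 2 by lia.
  by rewrite Ey Ex in hn *; nia.
have uC : uniq C by case: lC => /and3P[].
have uH : uniq H by case/and3P: cH.
have cn : size C + size H <= #|G|.
  rewrite -size_cat; have uCH : uniq (C ++ H).
    by rewrite cat_uniq uC uH andbT /=; apply/hasPn => v /HC.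
  by rewrite -(card_uniqP uCH) max_card.
have [l0 kt lt] : [/\ 0 < lambda, d - lambda + 1 <= size H & lambda < size H].
  by split; lia.
have [long|dense] := long_or_dense lC cH HC Hmax degd kG l0 kt lt.
  (* Together with [hn] this leaves [t + 2 <= lambda.+1], although [lambda < t]. *)
  move: (size C) (size H) #|G| gt hn cn long => c t n; clear => gt hn cn.
  have E2 : d - lambda + 2 = (d - lambda + 1).+1 by rewrite addnS.
  rewrite E2 addn1 mulnS in hn; rewrite mulnC => le.
  by move: (lambda.+1 * _) hn le => m; clear -gt cn; lia.
(* With [m = d - lambda], [dense] amounts to [t * m + 2 * lambda + 1 <= n] and [hn] to
   [n <= lambda.+1 * m + 2 * lambda], impossible for [lambda < t]. *)
move: (size H) #|G| gt hn dense => t n; clear -hlam => gt hn.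
have [m Em] : exists m, d = lambda + m by exists (d - lambda); lia.
have E2 : d - lambda = m by lia.
rewrite E2 in gt hn; have [x Ex] : exists x, t = lambda.+1 + x by exists (t - lambda.+1); lia.
have [l El] : exists l, lambda = l.+1 by exists lambda.-1; lia.
by rewrite Em Ex El in gt hn *; nia.
Qed.
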